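(* Let $\mathbb E$ be a product system over $\mathbb Z_+^k$ over $\mathcal A=\mathbb C$, with fibers $E_i=\mathcal H_i$ Hilbert spaces with fixed orthonormal bases $\{e^i_\alpha:\alpha\in J_i\}$ and unitary flips $t_{ij}:\mathcal H_i\otimes\mathcal H_j\to\mathcal H_j\otimes\mathcal H_i$. Let $\mathcal H$ be a Hilbert space, $\sigma(\lambda)=\lambda I_{\mathcal H}$, let $T_i:\mathcal H_i\to\mathcal B(\mathcal H)$ be linear maps ($i\in I_k$), and let $\{U_{ij}\}_{i\ne j}$ be unitaries on $\mathcal H$ with $U_{ji}=U_{ij}^*$, each commuting with all operators $T_\ell(\xi)$ ($\ell\in I_k$, $\xi\in\mathcal H_\ell$). Then $(\sigma,T_1,\dots,T_k)$ is a twisted representation of $\mathbb E$ with respect to the twists $\{t_{ij}\otimes U_{ij}\}_{i\ne j}$ if and only if there is a family $\{S^i_\alpha:i\in I_k,\alpha\in J_i\}\subseteq\mathcal B(\mathcal H)$ with $T_i(\xi)h=\sum_{\alpha\in J_i}\langle e^i_\alpha,\xi\rangle S^i_\alpha h$ for all $\xi\in\mathcal H_i$, $h\in\mathcal H$ (in particular $S^i_\alpha h=\widetilde T_i(e^i_\alpha\otimes h)$), such that for every $i\in I_k$ $$\sum_{\alpha\in J_i}S^i_\alpha(S^i_\alpha)^*\le I_{\mathcal H},$$ and for all $i\ne j$ in $I_k$, $\alpha\in J_i$, $\beta\in J_j$, $$S^i_\alpha S^j_\beta=\sum_{\gamma\in J_j,\ \delta\in J_i}\big\langle e^j_\gamma\otimes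 e^i_\delta,\ t_{ij}(e^i_\alpha\otimes e^j_\beta)\big\rangle S^j_\gamma S^i_\delta U_{ij}.$$ Moreover, $(\sigma,T_1,\dots,T_k)$ is a doubly twisted representation if and only if, in addition, for all $i\ne j$, $\alpha\in J_i$, $\beta\in J_j$, $$(S^j_\beta)^*S^i_\alpha=\sum_{\delta\in J_i,\ \gamma\in J_j}\big\langle e^j_\beta\otimes e^i_\delta,\ t_{ij}(e^i_\alpha\otimes e^j_\gamma)\big\rangle S^i_\delta U_{ij}(S^j_\gamma)^*.$$
   Context: Hilbert spaces are complex and separable, inner products conjugate-linear in the first variable; $I_k=\{1,\dots,k\}$. Infinite sums of operators converge in the strong operator topology; in the last sum one sums over $\delta$ for each fixed $\gamma$ and then over $\gamma$. A product system over $\mathbb Z_+^k$ with $\mathcal A=\mathbb C$ consists of Hilbert spaces $\mathcal H_1,\dots,\mathcal H_k$ and unitaries $t_{ij}:\mathcal H_i\otimes\mathcal H_j\to\mathcal H_j\otimes\mathcal H_i$ with $t_{ij}=t_{ji}^{-1}$, $t_{ii}=\mathrm{id}$ and $(I\otimes t_{ij})(t_{i\ell}\otimes I)(I\otimes t_{j\ell})=(t_{j\ell}\otimes I)(I\otimes t_{i\ell})(t_{ij}\otimes I)$ on $\mathcal H_i\otimes\mathcal H_j\otimes\mathcal H_\ell$ for distinct $i,j,\ell$. $(\sigma,T_1,\dots,T_k)$ is a twisted representation with twists $t_{ij}\otimes U_{ij}$ if each $T_i:\mathcal H_i\to\mathcal B(\mathcal H)$ is linear and completely contractive (equivalently $\widetilde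 T_i(\xi\otimes h)=T_i(\xi)h$ defines a contraction $\widetilde T_i:\mathcal H_i\otimes\mathcal H\to\mathcal H$), the $U_{ij}$ are unitaries with $U_{ji}=U_{ij}^*$ and $U_{ij}\widetilde T_\ell=\widetilde T_\ell(I\otimes U_{ij})$ for all $i\ne j$, $\ell$, and $\widetilde T_i(I_{\mathcal H_i}\otimes\widetilde T_j)=\widetilde T_j(I_{\mathcal H_j}\otimes\widetilde T_i)(t_{ij}\otimes U_{ij})$ for $i\neq j$. It is doubly twisted if moreover $\widetilde T_j^*\widetilde T_i=(I_{\mathcal H_j}\otimes\widetilde T_i)(t_{ij}\otimes U_{ij})(I_{\mathcal H_i}\otimes\widetilde T_j^* )$ for $i\ne j$. *)

(* Defs.v *)
From HB Require Import structures.
From mathcomp Require Import all_boot all_order all_algebra finmap complex.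
From mathcomp Require Import all_classical all_reals all_analysis.
From mathcomp.analysis Require Import showcase.summability.
From mathcomp Require Import ring lra.
Set Implicit Arguments. Unset Strict Implicit. Unset Printing Implicit Defensive.
Import Order.TTheory GRing.Theory Num.Theory.
Import numFieldNormedType.Exports.
Local Open Scope classical_set_scope.
Local Open Scope ring_scope.

(* The inner product is conjugate-linear in its first argument. *)
HB.mixin Record CompleteNormedModule_isHilbert (R : realType) V
    & CompleteNormedModule R[i] V := {
  inner : V -> V -> R[i] ;
  innerPr : forall x y z (a : R[i]),
    inner x (a *: y + z) = a * inner x y + inner x z ;
  inner_conj : forall x y, inner y x = (inner x y)^* ;
  inner_norm : forall x, inner x x = `|x| ^+ 2
}.
#[short(type="hilbertType")]
HB.structure Definition Hilbert (R : realType) :=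
  {V of CompleteNormedModule_isHilbert R V & CompleteNormedModule R[i] V}.

Section ReLemmas.
Context {R : realType}.
Local Notation C := R[i].
Implicit Types (z w : C) (t : R).
Lemma ReD z w : complex.Re (z + w) = complex.Re z + complex.Re w.
Proof. by case: z; case: w. Qed.
Lemma ReB z w : complex.Re (z - w) = complex.Re z - complex.Re w.
Proof. by case: z; case: w. Qed.
Lemma Re_conj z : complex.Re z^* = complex.Re z.
Proof. by case: z. Qed.
Lemma Re_real_mul t z : complex.Re (t%:C%C * z) = t * complex.Re z.
Proof. by case: z => a b /=; rewrite mul0r subr0. Qed.
Lemma ge0_Re z : 0 <= z -> 0 <= complex.Re z.
Proof. by rewrite lecE => /andP[]. Qed.
Lemma conj_realc t : (t%:C%C)^* = t%:C%C.
Proof. exact: conjc_real. Qed.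
End ReLemmas.

(* The Hilbert tensor product is built as the reproducing kernel Hilbert space
   of the kernel ((x, y), (x', y')) |-> <x, x'> <y, y'>.  For a positive definite
   kernel k on X, a formal sum u of points with complex coefficients stands for
   the vector [kvec u] = \sum c k(-, x), [kev f u] is its inner product with f, and
   the squared norm of f is [kN f] = sup_u (2 Re <u, f> - <u, u>); the space is the
   set of functions for which it is finite. *)
Record pdkernel (R : realType) (X : Type) := Kernel {
  kerf :> X -> X -> R[i] ;
  kernel_herm : forall x y, kerf y x = (kerf x y)^* ;
  kernel_ge0 : forall u : seq (R[i] * X),
    0 <= \sum_(p <- u) \sum_(q <- u) (p.1^* * q.1) * kerf p.2 q.2 }.

Section Kernel.
Context {R : realType} {X : Type} (k : pdkernel R X).
Local Notation C := R[i].
Local Notation F := (X -> C^o).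
Local Notation E := (seq (C * X)).
Implicit Types (f g : F) (u v : E) (c : C).

Definition kev f u : C := \sum_(p <- u) p.1^* * (f p.2 : C).
Definition kscale c u : E := [seq (c * p.1, p.2) | p <- u].
Definition kvec u : F := fun x => \sum_(q <- u) q.1 * k x q.2.

Lemma kevD f g u : kev (f + g) u = kev f u + kev g u.
Proof.
by rewrite /kev -big_split; apply: eq_bigr => p _ /=; rewrite -mulrDr.
Qed.
Lemma kevZ c f u : kev (c *: f) u = c * kev f u.
Proof.
rewrite /kev mulr_sumr; apply: eq_bigr => p _.
by rewrite [(c *: f) _]/(c * f _) mulrCA.
Qed.
Lemma kevN f u : kev (- f) u = - kev f u.
Proof. by rewrite -scaleN1r kevZ mulN1r. Qed.
Lemma kevB f g u : kev (f - g) u = kev f u - kev g u.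
Proof. by rewrite kevD kevN. Qed.
Lemma kev_cat f u v : kev f (u ++ v) = kev f u + kev f v.
Proof. by rewrite /kev big_cat. Qed.
Lemma kev_scale c f u : kev f (kscale c u) = c^* * kev f u.
Proof.
rewrite /kev big_map mulr_sumr; apply: eq_bigr => p _ /=.
by rewrite rmorphM mulrA.
Qed.
Lemma kev_nil f : kev f [::] = 0.
Proof. by rewrite /kev big_nil. Qed.

Lemma kvec_cat u v : kvec (u ++ v) = kvec u + kvec v.
Proof. by apply/funext => x; rewrite /kvec big_cat. Qed.
Lemma kvec_scale c u : kvec (kscale c u) = c *: kvec u.
Proof.
apply/funext => x; rewrite /kvec big_map [RHS]mulr_sumr.
by apply: eq_bigr => p _ /=; rewrite mulrA.
Qed.
Lemma kvec_nil : kvec [::] = 0.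
Proof. by apply/funext => x; rewrite /kvec big_nil. Qed.

Lemma kev_kvec_conj u v : kev (kvec v) u = (kev (kvec u) v)^*.
Proof.
rewrite /kev /kvec rmorph_sum.
under eq_bigr do rewrite mulr_sumr.
rewrite exchange_big /=; apply: eq_bigr => p _.
rewrite rmorphM /= conjCK rmorph_sum mulr_sumr; apply: eq_bigr => q _.
by rewrite rmorphM /= -kernel_herm; ring.
Qed.

Definition kq u : R := complex.Re (kev (kvec u) u).
Definition kre f u : R := complex.Re (kev f u).

Lemma kq_ge0 u : 0 <= kq u.
Proof.
apply: ge0_Re; apply: le_trans (kernel_ge0 k u) _.
rewrite le_eqVlt; apply/orP; left; apply/eqP; apply: eq_bigr => p _.
by rewrite /kvec mulr_sumr; apply: eq_bigr => q _; rewrite mulrA.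
Qed.
Lemma kreD f g u : kre (f + g) u = kre f u + kre g u.
Proof. by rewrite /kre kevD ReD. Qed.
Lemma kreB f g u : kre (f - g) u = kre f u - kre g u.
Proof. by rewrite /kre kevB ReB. Qed.
Lemma kre_cat f u v : kre f (u ++ v) = kre f u + kre f v.
Proof. by rewrite /kre kev_cat ReD. Qed.
Lemma kreZ c f u : kre (c *: f) u = kre f (kscale c^* u).
Proof. by rewrite /kre kevZ kev_scale conjCK. Qed.
Lemma kre_scaler (t : R) f u : kre f (kscale t%:C%C u) = t * kre f u.
Proof. by rewrite /kre kev_scale conj_realc Re_real_mul. Qed.
Lemma kreC u v : kre (kvec v) u = kre (kvec u) v.
Proof. by rewrite /kre kev_kvec_conj Re_conj. Qed.
Lemma kq_cat u v : kq (u ++ v) = kq u + kq v + 2 * kre (kvec v) u.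
Proof.
rewrite /kq kvec_cat kevD !kev_cat !ReD -!/(kre _ _) (kreC v u) /kre; ring.
Qed.
Lemma kq_scale c u : kq (kscale c u) = (complex.Re c ^+ 2 + complex.Im c ^+ 2) * kq u.
Proof.
rewrite /kq kvec_scale kevZ kev_scale mulrA -Re_real_mul; congr complex.Re.
by rewrite add_Re2_Im2 sqr_normc.
Qed.
Lemma kq_scaler (t : R) u : kq (kscale t%:C%C u) = t ^+ 2 * kq u.
Proof. by rewrite kq_scale /= expr0n addr0. Qed.
Lemma kq_nil : kq [::] = 0.
Proof. by rewrite /kq kev_nil. Qed.

Definition kG f u : R := 2 * kre f u - kq u.
Definition kbounded f : Prop := exists M, forall u, kG f u <= M.
Definition kN f : R := sup (range (kG f)).

Lemma kG_nil f : kG f [::] = 0.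
Proof. by rewrite /kG /kre kev_nil kq_nil mulr0 subrr. Qed.
Lemma kN_ub f u : kbounded f -> kG f u <= kN f.
Proof.
case=> M Mf; apply: ub_le_sup; last by exists u.
by exists M => _ [v _ <-].
Qed.
Lemma kN_le f M : (forall u, kG f u <= M) -> kN f <= M.
Proof.
by move=> Mf; apply: ge_sup => [|_ [v _ <-]//]; exists (kG f [::]), [::].
Qed.
Lemma kN_ge0 f : kbounded f -> 0 <= kN f.
Proof. by move=> /(kN_ub [::]); rewrite kG_nil. Qed.

Lemma kG_weight f g (a b : R) u : 0 < a -> 0 < b -> a + b = 1 ->
  kG (f + g) u =
    a^-1 * kG f (kscale a%:C%C u) + b^-1 * kG g (kscale b%:C%C u).
Proof.
move=> a0 b0 ab; rewrite /kG kreD !kre_scaler !kq_scaler.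
have an0 : a != 0 by rewrite gt_eqF. have bn0 : b != 0 by rewrite gt_eqF.
have -> : b = 1 - a by rewrite -ab; ring.
by field; rewrite an0 -ab addrAC subrr add0r bn0.
Qed.

Lemma kN_weight f g (a b : R) : 0 < a -> 0 < b -> a + b = 1 ->
  kbounded f -> kbounded g ->
  kbounded (f + g) /\ kN (f + g) <= a^-1 * kN f + b^-1 * kN g.
Proof.
move=> a0 b0 ab bf bg.
have H u : kG (f + g) u <= a^-1 * kN f + b^-1 * kN g.
  rewrite (kG_weight _ _ _ a0 b0 ab); apply: lerD.
    by rewrite ler_pM2l ?invr_gt0// kN_ub.
  by rewrite ler_pM2l ?invr_gt0// kN_ub.
by split; [exists (a^-1 * kN f + b^-1 * kN g)|exact: kN_le].
Qed.

Lemma kboundedD f g : kbounded f -> kbounded g -> kbounded (f + g).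
Proof. by move=> bf bg; case: (@kN_weight f g 2^-1 2^-1) => //; lra. Qed.

Lemma kG_scale c f u : c != 0 ->
  kG (c *: f) (kscale c u) =
  (complex.Re c ^+ 2 + complex.Im c ^+ 2) * kG f u.
Proof.
move=> c0; rewrite /kG kq_scale {1}/kre kevZ kev_scale mulrA -sqr_normc.
by rewrite -add_Re2_Im2 Re_real_mul -/(kre _ _); ring.
Qed.

Lemma kscaleK c u : c != 0 -> kscale c (kscale c^-1 u) = u.
Proof.
move=> c0; rewrite /kscale -map_comp -[RHS]map_id; apply: eq_map => -[d x] /=.
by rewrite mulVKf.
Qed.

Definition sqmod c : R := complex.Re c ^+ 2 + complex.Im c ^+ 2.
Lemma sqmodE c : (sqmod c)%:C%C = `|c| ^+ 2. Proof. exact: add_Re2_Im2. Qed.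
Lemma sqmod_ge0 c : 0 <= sqmod c.
Proof. by rewrite addr_ge0// sqr_ge0. Qed.

Lemma kbounded0 : kbounded 0.
Proof.
exists 0 => u; have := kq_ge0 u; rewrite /kG /kre /kev.
rewrite (_ : \sum_(p <- u) _ = 0) ?mulr0 ?sub0r ?oppr_le0//.
by rewrite big1// => p _; rewrite mulr0.
Qed.
Lemma kN0 : kN 0 = 0.
Proof.
apply/le_anti/andP; split; last exact/kN_ge0/kbounded0.
apply: kN_le => u; have := kq_ge0 u; rewrite /kG /kre /kev.
rewrite (_ : \sum_(p <- u) _ = 0) ?mulr0 ?sub0r ?oppr_le0//.
by rewrite big1// => p _; rewrite mulr0.
Qed.

Lemma kN_scale_le c f : kbounded f ->
  kbounded (c *: f) /\ kN (c *: f) <= sqmod c * kN f.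
Proof.
move=> bf; have [->|c0] := eqVneq c 0.
  rewrite scale0r kN0 /sqmod /= expr0n addr0 mul0r; split => //.
  exact: kbounded0.
have H u : kG (c *: f) u <= sqmod c * kN f.
  rewrite -(kscaleK u c0) kG_scale// ler_wpM2l ?sqmod_ge0//.
  exact: kN_ub.
by split; [exists (sqmod c * kN f)|exact: kN_le].
Qed.
Lemma kboundedZ c f : kbounded f -> kbounded (c *: f).
Proof. by move=> /(kN_scale_le c)[]. Qed.
Lemma kNZ c f : kbounded f -> kN (c *: f) = sqmod c * kN f.
Proof.
move=> bf; apply/le_anti/andP; split; first exact: (kN_scale_le c bf).2.
have [->|c0] := eqVneq c 0.
  by rewrite /sqmod /= expr0n addr0 mul0r; apply/kN_ge0/kboundedZ.
have := (kN_scale_le c^-1 (kboundedZ c bf)).2.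
rewrite scalerA mulVf// scale1r => le1.
apply: le_trans (ler_wpM2l (sqmod_ge0 c) le1) _; rewrite mulrA.
suff -> : sqmod c * sqmod c^-1 = 1 by rewrite mul1r.
apply: complexI; rewrite rmorphM /= !sqmodE -exprMn -normrM mulfV//.
by rewrite normr1 expr1n.
Qed.

Definition knorm f : R := Num.sqrt (kN f).
Lemma knorm_ge0 f : 0 <= knorm f. Proof. exact: sqrtr_ge0. Qed.
Lemma sqr_knorm f : kbounded f -> knorm f ^+ 2 = kN f.
Proof. by move=> bf; rewrite sqr_sqrtr// kN_ge0. Qed.

Lemma ler_knormD f g : kbounded f -> kbounded g ->
  knorm (f + g) <= knorm f + knorm g.
Proof.
move=> bf bg; have bfg := kboundedD bf bg.
apply/ler_addgt0Pr => e e0.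
pose s := knorm f + e / 2; pose t := knorm g + e / 2.
have s0 : 0 < s by rewrite ltr_wpDl ?knorm_ge0// divr_gt0.
have t0 : 0 < t by rewrite ltr_wpDl ?knorm_ge0// divr_gt0.
have st0 : 0 < s + t by rewrite addr_gt0.
have sn0 : s != 0 by rewrite gt_eqF. have tn0 : t != 0 by rewrite gt_eqF.
have stn0 : s + t != 0 by rewrite gt_eqF.
have a0 : 0 < s / (s + t) by rewrite divr_gt0.
have b0 : 0 < t / (s + t) by rewrite divr_gt0.
have ab : s / (s + t) + t / (s + t) = 1 by rewrite -mulrDl mulfV.
have [_] := kN_weight a0 b0 ab bf bg.
rewrite -!sqr_knorm// => le1.
have -> : knorm f + knorm g + e = s + t by rewrite /s /t; field.
rewrite -(@ler_pXn2r _ 2) ?nnegrE ?knorm_ge0 ?(ltW st0)//.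
apply: le_trans le1 _.
rewrite (_ : (s + t) ^+ 2 = (s / (s + t))^-1 * s ^+ 2 + (t / (s + t))^-1 * t ^+ 2); last first.
  by field; rewrite sn0 tn0 stn0.
have fs : knorm f <= s by rewrite lerDl divr_ge0// ltW.
have gt : knorm g <= t by rewrite lerDl divr_ge0// ltW.
apply: lerD; rewrite ler_wpM2l ?invr_ge0 ?divr_ge0 ?(ltW s0) ?(ltW t0) ?(ltW st0)//.
- by rewrite ler_pXn2r// nnegrE ?knorm_ge0// ltW.
- by rewrite ler_pXn2r// nnegrE ?knorm_ge0// ltW.
Qed.

Lemma kre_le f u : kbounded f -> kre f u <= knorm f * Num.sqrt (kq u).
Proof.
move=> bf; have qu := kq_ge0 u.
have H (t : R) : 2 * (t * kre f u) - t ^+ 2 * kq u <= knorm f ^+ 2.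
  have := kN_ub (kscale t%:C%C u) bf.
  by rewrite sqr_knorm// /kG kre_scaler kq_scaler.
have := knorm_ge0 f; set n := knorm f in H *; move=> n0.
have qE : Num.sqrt (kq u) ^+ 2 = kq u by rewrite sqr_sqrtr.
have := sqrtr_ge0 (kq u); set r := Num.sqrt _ in qE *; move=> r0.
set x := kre f u in H *; rewrite -qE in H.
have [re0|rne0] := eqVneq r 0.
  rewrite re0 mulr0 leNgt; apply/negP => x0.
  have := H ((n ^+ 2 + 1) / x); rewrite re0 expr0n mulr0 subr0 mulfVK ?gt_eqF//.
  by have := sqr_ge0 n; lra.
have rp : 0 < r by rewrite lt_neqAle eq_sym rne0.
have := H (n / r); rewrite expr_div_n mulfVK ?sqrf_eq0 ?gt_eqF// => le1.
have [ne0|nn0] := eqVneq n 0.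
  rewrite ne0 mul0r leNgt; apply/negP => x0.
  have := H (x / r ^+ 2); rewrite ne0 expr0n /=.
  rewrite (_ : _ - _ = x ^+ 2 / r ^+ 2); last by field.
  by rewrite leNgt divr_gt0// exprn_gt0.
have np : 0 < n by rewrite lt_neqAle eq_sym nn0.
have : n / r * x <= n ^+ 2 by lra.
by rewrite mulrAC ler_pdivrMr// expr2 -mulrA ler_pM2l.
Qed.

Lemma knorm_eq0 f : kbounded f -> knorm f = 0 -> f = 0.
Proof.
move=> bf f0; apply/funext => x.
have := kre_le [:: (f x : C, x)] bf.
rewrite f0 mul0r /kre /kev big_seq1 /= mulrC -sqr_normc => le0.
have : (`|f x : C| ^+ 2 : C) <= 0.
  rewrite -add_Re2_Im2 in le0 *.
  by rewrite (lecR _ 0).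
rewrite -normrX normr_le0 sqrf_eq0 => /eqP ->.
by [].
Qed.

Lemma kG_kvec u v : kG (kvec u) v <= kq u.
Proof.
have := kq_ge0 (u ++ kscale (-1)%:C%C v).
by rewrite kq_cat kreC kre_scaler kq_scaler sqrrN expr1n mul1r /kG; lra.
Qed.
Lemma kvec_bounded u : kbounded (kvec u).
Proof. by exists (kq u) => v; exact: kG_kvec. Qed.
Lemma kN_kvec u : kN (kvec u) = kq u.
Proof.
apply/le_anti/andP; split; first by apply: kN_le => v; exact: kG_kvec.
have := kN_ub u (kvec_bounded u); rewrite /kG.
have -> : kre (kvec u) u = kq u by [].
by lra.
Qed.

Lemma kG_sub f u v : kG (f - kvec u) v = kG f (u ++ v) - kG f u.
Proof. by rewrite /kG kreB kre_cat kq_cat (kreC v u); ring. Qed.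

Lemma kvec_dense f (e : R) : kbounded f -> 0 < e ->
  exists u, knorm (f - kvec u) < e.
Proof.
move=> bf e0.
have e20 : 0 < e ^+ 2 / 2 by rewrite divr_gt0// exprn_gt0.
have [|_ [u _ <-] uP] := @sup_adherent R (range (kG f)) _ e20.
  split; first by exists (kG f [::]), [::].
  by case: bf => M Mf; exists M => _ [v _ <-].
exists u; rewrite -(@ltr_pXn2r _ 2) ?nnegrE ?knorm_ge0 ?(ltW e0)//.
have bfu : kbounded (f - kvec u).
  by rewrite -scaleN1r; apply: kboundedD => //; apply/kboundedZ/kvec_bounded.
rewrite sqr_knorm//; apply: (@le_lt_trans _ _ (e ^+ 2 / 2)); last by lra.
apply: kN_le => v; rewrite kG_sub.
have := kN_ub (u ++ v) bf.
rewrite -/(kN f) in uP; lra.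
Qed.
End Kernel.

Section KernelInner.
Context {R : realType} {X : Type} (k : pdkernel R X).
Local Notation C := R[i].
Local Notation F := (X -> C^o).
Implicit Types (f g h : F) (c : C).
Local Notation bounded := (kbounded k).
Local Notation N := (kN k).

Lemma kboundedN f : bounded f -> bounded (- f).
Proof. by rewrite -scaleN1r; exact: kboundedZ. Qed.
Lemma kboundedB f g : bounded f -> bounded g -> bounded (f - g).
Proof. by move=> bf bg; exact/kboundedD/kboundedN. Qed.
Lemma kNN f : bounded f -> N (- f) = N f.
Proof.
by move=> bf; rewrite -scaleN1r kNZ// /sqmod /= oppr0 expr0n addr0 sqrrN expr1n mul1r.
Qed.
Lemma kNZr (t : R) f : bounded f -> N (t%:C%C *: f) = t ^+ 2 * N f.
Proof. by move=> bf; rewrite kNZ// /sqmod /= expr0n addr0. Qed.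

Lemma kre_kvec_scaler (t : R) u v :
  kre (kvec k (kscale t%:C%C u)) v = t * kre (kvec k u) v.
Proof. by rewrite kreC kre_scaler kreC. Qed.
Lemma kreN f u : kre (- f) u = - kre f u.
Proof. by rewrite /kre kevN; case: (kev f u). Qed.

Lemma kparallelogram_le f g : bounded f -> bounded g ->
  N (f + g) + N (f - g) <= 2 * N f + 2 * N g.
Proof.
move=> bf bg.
rewrite -lerBrDr; apply: kN_le => u; rewrite lerBrDr -lerBrDl.
apply: kN_le => v; rewrite lerBrDl.
pose a := kscale 2^-1%:C%C (u ++ v).
pose b := kscale 2^-1%:C%C (u ++ kscale (-1)%:C%C v).
have := kN_ub a bf; have := kN_ub b bg.
rewrite /kG !kreD !kreN !kre_scaler !kq_scaler !kre_cat !kq_cat.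
rewrite !kre_kvec_scaler !kre_scaler !kq_scaler; lra.
Qed.

Lemma kparallelogram f g : bounded f -> bounded g ->
  N (f + g) + N (f - g) = 2 * N f + 2 * N g.
Proof.
move=> bf bg; apply/le_anti; rewrite kparallelogram_le//=.
have := kparallelogram_le (kboundedD bf bg) (kboundedB bf bg).
rewrite (_ : f + g + (f - g) = 2%:C%C *: f); last first.
  by rewrite rmorph_nat scaler_nat addrACA subrr addr0 mulr2n.
rewrite (_ : f + g - (f - g) = 2%:C%C *: g); last first.
  by rewrite rmorph_nat scaler_nat opprB addrC addrA subrK mulr2n.
by rewrite !kNZr//; lra.
Qed.

Definition kB f g : R := (N (f + g) - N (f - g)) / 4.

Lemma kBC f g : bounded f -> bounded g -> kB f g = kB g f.
Proof.
by move=> bf bg; rewrite /kB [g + f]addrC -[g - f]opprB (kNN (kboundedB bf bg)).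
Qed.
Lemma kBr0 f : kB f 0 = 0.
Proof. by rewrite /kB addr0 subr0 subrr mul0r. Qed.
Lemma kB_mid f g h : bounded f -> bounded g -> bounded h ->
  kB f (g + h) + kB f (g - h) = 2 * kB f g.
Proof.
move=> bf bg bh; rewrite /kB.
have := kparallelogram (kboundedD bf bg) bh.
have := kparallelogram (kboundedB bf bg) bh.
rewrite !addrA (_ : f - (g - h) = f - g + h); last by rewrite opprB addrA addrAC.
rewrite (_ : f - (g + h) = f - g - h); last by rewrite opprD addrA.
lra.
Qed.
Lemma kBDr f g h : bounded f -> bounded g -> bounded h ->
  kB f (g + h) = kB f g + kB f h.
Proof.
move=> bf bg bh.
pose a : F := 2^-1%:C%C *: (g + h); pose b : F := 2^-1%:C%C *: (g - h).
have ba : bounded a by exact/kboundedZ/kboundedD.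
have bb : bounded b by exact/kboundedZ/kboundedB.
have hf (x : F) : 2^-1%:C%C *: x + 2^-1%:C%C *: x = x.
  by rewrite -scalerDl -rmorphD /= (_ : 2^-1 + 2^-1 = 1 :> R) ?scale1r//; lra.
have ga : a + b = g by rewrite /a /b -scalerDr addrACA subrr addr0 scalerDr hf.
have ha : a - b = h.
  by rewrite /a /b -scalerBr opprB addrC addrA subrK scalerDr hf.
have aa : a + a = g + h by rewrite /a hf.
have := kB_mid bf ba bb; have := kB_mid bf ba ba.
by rewrite ga ha aa subrr kBr0 addr0 => -> ->.
Qed.
Lemma kBNr f g : bounded f -> bounded g -> kB f (- g) = - kB f g.
Proof.
by move=> bf bg; apply/eqP; rewrite -addr_eq0 -kBDr ?addNr ?kBr0//; exact: kboundedN.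
Qed.

Lemma kB_norm f : bounded f -> kB f f = N f.
Proof.
move=> bf; rewrite /kB subrr kN0 subr0.
have -> : f + f = 2%:C%C *: f by rewrite rmorph_nat scaler_nat mulr2n.
by rewrite kNZr//; lra.
Qed.
Lemma kBZ c f g : bounded f -> bounded g ->
  kB (c *: f) (c *: g) = sqmod c * kB f g.
Proof.
move=> bf bg; rewrite /kB -scalerDr -scalerBr !kNZ ?mulrA ?mulrBr//.
- exact: kboundedB.
- exact: kboundedD.
Qed.

Lemma kB_kvec f u : bounded f -> kB f (kvec k u) = kre f u.
Proof.
move=> bf; rewrite /kB.
have NB v : N (f - kvec k v) = N f - kG k f v.
  apply/le_anti/andP; split.
    by apply: kN_le => w; rewrite kG_sub lerD2r; exact: kN_ub.
  rewrite lerBlDr; apply: kN_le => w; rewrite -lerBlDr.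
  have bfv := kboundedB bf (kvec_bounded k v).
  have := kN_ub (kscale (-1)%:C%C v ++ w) bfv; rewrite kG_sub.
  suff -> : kG k f (v ++ kscale (-1)%:C%C v ++ w) = kG k f w by [].
  rewrite /kG !kre_cat !kq_cat kvec_cat kreD.
  rewrite ?kre_kvec_scaler !kre_scaler !kq_scaler ?kre_kvec_scaler ?kre_scaler.
  have -> : kq k v = kre (kvec k v) v by [].
  by rewrite (kreC k v w); ring.
have fm : f + kvec k u = f - kvec k (kscale (-1)%:C%C u).
  by rewrite kvec_scale rmorphN1 scaleN1r opprK.
by rewrite fm !NB /kG kre_scaler kq_scaler; lra.
Qed.

Lemma kB_le f g : bounded f -> bounded g -> kB f g <= knorm k f * knorm k g.
Proof.
move=> bf bg; have := ler_knormD bf bg.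
have bfg := kboundedB bf bg.
have h1 : knorm k f <= knorm k (f - g) + knorm k g.
  by have := ler_knormD bfg bg; rewrite subrK.
have h2 : knorm k g <= knorm k (f - g) + knorm k f.
  have := ler_knormD (kboundedN bfg) bf.
  by rewrite [knorm k (- (f - g))]/knorm (kNN bfg) opprB subrK.
rewrite /kB -(sqr_knorm (kboundedD bf bg)) -(sqr_knorm bfg) => h3.
have := knorm_ge0 k f; have := knorm_ge0 k g.
have := knorm_ge0 k (f + g); have := knorm_ge0 k (f - g).
move: h1 h2 h3; move: (knorm k f) (knorm k g) (knorm k (f + g)) (knorm k (f - g)).
move=> a b s d h1 h2 h3 d0 s0 b0 a0.
have : s ^+ 2 <= (a + b) ^+ 2 by rewrite ler_pXn2r// nnegrE addr_ge0.
have : (a - b) ^+ 2 <= d ^+ 2.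
  by rewrite -subr_ge0 subr_sqr mulr_ge0//; lra.
rewrite !sqrrD sqrrN; lra.
Qed.
Lemma kB_abs f g : bounded f -> bounded g -> `|kB f g| <= knorm k f * knorm k g.
Proof.
move=> bf bg; rewrite ler_norml kB_le// andbT lerNl -kBNr//.
by apply: le_trans (kB_le bf (kboundedN bg)) _; rewrite {2}/knorm kNN.
Qed.

Lemma kBZr (t : R) f g : bounded f -> bounded g ->
  kB f (t%:C%C *: g) = t * kB f g.
Proof.
move=> bf bg; apply/eqP; rewrite -subr_eq0 -normr_le0.
apply/ler_addgt0Pr => e e0; rewrite add0r.
pose K := (1 + `|t|) * (knorm k f + 1) * 2.
have K0 : 0 < K.
  rewrite !mulr_gt0// ?ltr_wpDl ?knorm_ge0// ltr_wpDr//.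
have [u ue] := kvec_dense bg (divr_gt0 e0 K0).
set h := g - kvec k u in ue.
have bh : bounded h := kboundedB bg (kvec_bounded k u).
have -> : kB f (t%:C%C *: g) - t * kB f g = kB f (t%:C%C *: h) - t * kB f h.
  rewrite (_ : g = h + kvec k u); last by rewrite subrK.
  have bu := kvec_bounded k u.
  rewrite scalerDr (kBDr bf (kboundedZ _ bh) (kboundedZ _ bu)) (kBDr bf bh bu).
  by rewrite -kvec_scale !kB_kvec// kre_scaler; ring.
have nt : knorm k (t%:C%C *: h) = `|t| * knorm k h.
  by rewrite /knorm kNZr// sqrtrM ?sqr_ge0// sqrtr_sqr.
have h1 := kB_abs bf (kboundedZ t%:C%C bh).
have h2 := kB_abs bf bh; rewrite nt in h1.
apply: le_trans (ler_normB _ _) _; rewrite (normrM t).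
apply: (@le_trans _ _ (K * knorm k h)).
  have := ler_wpM2l (normr_ge0 t) h2.
  have := knorm_ge0 k f; have := knorm_ge0 k h; have := normr_ge0 t.
  move: h1; rewrite /K; move: `|kB _ _| (`|t|) (knorm k f) (knorm k h) (`|kB _ _|).
  move=> x a b c y hx a0 c0 b0 hy.
  have : 0 <= b * c by rewrite mulr_ge0.
  have : 0 <= a * (b * c) by rewrite !mulr_ge0.
  have : 0 <= a * c by rewrite mulr_ge0.
  by lra.
by rewrite mulrC -ler_pdivlMr// ltW.
Qed.

Definition kinner f g : C := Complex (kB f g) (- kB f ('i *: g)).

Lemma sqmod_i : sqmod ('i : C) = 1.
Proof. by apply: complexI; rewrite sqmodE normCi expr1n. Qed.
Lemma kBi f g : bounded f -> bounded g -> kB ('i *: f) g = - kB f ('i *: g).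
Proof.
move=> bf bg.
have {1}-> : g = 'i *: (- ('i *: g)).
  by rewrite scalerN scalerA -expr2 sqrCi scaleN1r opprK.
by rewrite kBZ ?kBNr ?sqmod_i ?mul1r//; [exact: kboundedZ|exact/kboundedN/kboundedZ].
Qed.
Lemma kinner_conj f g : bounded f -> bounded g -> kinner g f = (kinner f g)^*.
Proof.
move=> bf bg; rewrite /kinner; apply/eqP; rewrite eq_complex /= opprK.
rewrite (kBC bg bf) eqxx /=; apply/eqP.
by rewrite -kBi// kBC//; exact: kboundedZ.
Qed.
Lemma kinnerPr f g h c : bounded f -> bounded g -> bounded h ->
  kinner f (c *: g + h) = c * kinner f g + kinner f h.
Proof.
move=> bf bg bh.
have ZE (x : F) : c *: x = (complex.Re c)%:C%C *: x + (complex.Im c)%:C%C *: ('i *: x).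
  rewrite scalerA -scalerDl; congr (_ *: _).
  by rewrite {1}(complexE c) complexiE mulrC [_ * 'i]mulrC mulrC.
have B1 (x : F) : bounded x -> kB f (c *: x) =
    complex.Re c * kB f x + complex.Im c * kB f ('i *: x).
  move=> bx; rewrite ZE kBDr ?kBZr//; repeat exact: kboundedZ.
    by do 2 apply: kboundedZ.
rewrite /kinner scalerDr !kBDr//; repeat (apply: kboundedZ => //).
rewrite scalerA mulrC -scalerA !B1//; last exact: kboundedZ.
rewrite scalerA -expr2 sqrCi scaleN1r kBNr//.
apply/eqP; rewrite eq_complex; clear ZE B1; case: c => x y /=.
by apply/andP; split; apply/eqP; ring.
Qed.
Lemma kinner_norm f : bounded f -> kinner f f = (knorm k f)%:C%C ^+ 2.
Proof.
move=> bf; rewrite -rmorphXn /= sqr_knorm// /kinner kB_norm//.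
have := kBi bf bf; rewrite (kBC (kboundedZ 'i bf) bf) => /eqP.
by rewrite -addr_eq0 -mulr2n mulrn_eq0 /= => /eqP ->; rewrite oppr0.
Qed.
Lemma kinner_kvec f u : bounded f -> kinner (kvec k u) f = kev f u.
Proof.
move=> bf; rewrite (kinner_conj bf (kvec_bounded k u)) /kinner.
rewrite -kvec_scale !kB_kvec// /kre kev_scale conjCi.
rewrite -complexiE.
by case: (kev f u) => a b; apply/eqP; rewrite eq_complex /=; apply/andP; split; apply/eqP; ring.
Qed.
End KernelInner.

Section KernelSpace.
Context {R : realType} {X : Type} (k : pdkernel R X).
Local Notation C := R[i].

Definition kbounded_pred : {pred X -> C^o} := fun f => `[< kbounded k f >].
Lemma kbounded_submod : submod_closed kbounded_pred.
Proof.
split=> [|c f g /asboolP bf /asboolP bg]; first exact/asboolP/kbounded0.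
exact/asboolP/kboundedD/bg/kboundedZ.
Qed.
HB.instance Definition _ :=
  GRing.isSubmodClosed.Build _ _ kbounded_pred kbounded_submod.

Record kspace := KSpace {
  kspace_val : X -> C^o ; kspace_valP : kspace_val \in kbounded_pred }.
HB.instance Definition _ := [isSub for kspace_val].
HB.instance Definition _ := [Choice of kspace by <:].
HB.instance Definition _ := [SubChoice_isSubLmodule of kspace by <:].

Implicit Types f g : kspace.
Lemma kspaceP f : kbounded k (val f).
Proof. by apply/asboolP; exact: (kspace_valP f). Qed.

Definition kspace_norm f : C := (knorm k (val f))%:C%C.
Lemma kspace_normD f g : kspace_norm (f + g) <= kspace_norm f + kspace_norm g.
Proof.
by rewrite /kspace_norm -rmorphD /= lecR ler_knormD//; exact: kspaceP.
Qed.
Lemma kspace_normZ c f : kspace_norm (c *: f) = `|c| * kspace_norm f.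
Proof.
rewrite /kspace_norm /knorm linearZ /= kNZ; last exact: kspaceP.
rewrite sqrtrM ?sqmod_ge0// rmorphM /=; congr (_ * _).
by rewrite normc_def.
Qed.
Lemma kspace_norm_eq0 f : kspace_norm f = 0 -> f = 0.
Proof.
by move=> /complexI f0; apply/val_inj/(knorm_eq0 (kspaceP f)).
Qed.
HB.instance Definition _ := Lmodule_isNormed.Build C kspace
  kspace_normD kspace_normZ kspace_norm_eq0.

Lemma kspace_normE f : `|f| = (knorm k (val f))%:C%C. Proof. by []. Qed.

Lemma kspace_complete (G : set_system kspace) :
  ProperFilter G -> cauchy G -> cvg G.
Proof.
move=> PG /cauchyP cG.
have cauG (e : R) : 0 < e -> exists2 A, G A &
    forall f g, A f -> A g -> knorm k (val f - val g) <= e.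
  move=> e0; have e20 : 0 < (e / 2)%:C%C :> C by rewrite ltcR divr_gt0.
  have [f Gf] := cG _ e20; exists (ball f (e / 2)%:C%C) => // g h.
  rewrite -ball_normE /= !kspace_normE !ltcR !raddfB /= => fg fh.
  have bg := kspaceP g; have bh := kspaceP h; have bf := kspaceP f.
  have -> : val g - val h = - (val f - val g) + (val f - val h).
    by rewrite opprB addrA subrK.
  apply: le_trans (ler_knormD _ _) _; [exact/kboundedN/kboundedB|exact: kboundedB|].
  rewrite {1}/knorm kNN; last exact: kboundedB.
  by rewrite -/(knorm _ _); lra.
have cre (u : seq (C * X)) : cvg ((fun f => kre (val f) u) @ G).
  apply: R_complete; apply/cauchyP => e e0.
  have K0 : 0 < Num.sqrt (kq k u) + 1 by rewrite ltr_wpDl ?sqrtr_ge0.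
  have [A GA Ae] := cauG _ (divr_gt0 e0 K0).
  have [f Af] := filter_ex GA.
  exists (kre (val f) u); rewrite /= /nbhs /=.
  near=> g; rewrite /ball /= -kreB.
  have gA : A g by near: g.
  have bfg := kboundedB (kspaceP f) (kspaceP g).
  have bgf := kboundedB (kspaceP g) (kspaceP f).
  have h1 := Ae _ _ Af gA; have h2 := Ae _ _ gA Af.
  have s0 := sqrtr_ge0 (kq k u).
  have l1 := le_trans (kre_le u bfg) (ler_wpM2r s0 h1).
  have l2 := le_trans (kre_le u bgf) (ler_wpM2r s0 h2).
  have lt : e / (Num.sqrt (kq k u) + 1) * Num.sqrt (kq k u) < e.
    by rewrite mulrAC ltr_pdivrMr// mulrDr mulr1 ltrDl.
  rewrite ltr_norml (le_lt_trans l1 lt) andbT ltrNl.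
  apply: le_lt_trans lt; apply: le_trans l2.
  by rewrite !kreB opprB.
pose l (u : seq (C * X)) : R := lim ((fun f => kre (val f) u) @ G).
pose f0 : X -> C^o := fun x => Complex (l [:: (1, x)]) (l [:: ('i, x)]).
have re1 (f : X -> C^o) (c : C) x : kre f [:: (c, x)] =
    complex.Re c * kre f [:: (1, x)] + complex.Im c * kre f [:: ('i, x)].
  rewrite /kre /kev !big_seq1 /= -complexiE; case: c => a b.
  by case: (f x) => s t /=; ring.
have lE u : l u = kre f0 u.
  apply/cvg_lim => //; elim: u => [|[c x] u IH].
    rewrite (_ : (fun f => _) = cst 0); last first.
      by apply/funext => f; rewrite /kre kev_nil.
    by rewrite /kre kev_nil; exact: cvg_cst.
  rewrite -cat1s kre_cat.
  rewrite (_ : (fun f => _) = (fun f : kspace => kre (val f) [:: (c, x)] + kre (val f) u)); last first.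
    by apply/funext => f; rewrite kre_cat.
  apply: cvgD => //.
  have -> : kre f0 [:: (c, x)] = complex.Re c * l [:: (1, x)] + complex.Im c * l [:: ('i, x)].
    rewrite /kre /kev big_seq1 /= /f0; case: c => a b /=; ring.
  rewrite (_ : (fun f => _) = (fun f : kspace =>
    complex.Re c * kre (val f) [:: (1, x)] + complex.Im c * kre (val f) [:: ('i, x)])); last first.
    by apply/funext => f; rewrite re1.
  by apply: cvgD; apply: cvgMr; exact: cre.
have key (e : R) A : 0 < e -> G A ->
    (forall f g, A f -> A g -> knorm k (val f - val g) <= e) ->
    forall g, A g -> forall u, kG k (f0 - val g) u <= e ^+ 2.
  move=> e0 GA Ae g Ag u.
  have : (fun f : kspace => kG k (val f - val g) u) @ G --> kG k (f0 - val g) u.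
    rewrite /kG kreB -lE.
    rewrite (_ : (fun f => _) = (fun f : kspace => 2 * (kre (val f) u - kre (val g) u) - kq k u)).
      by apply: cvgB; [apply: cvgMr; apply: cvgB; [exact: cre|exact: cvg_cst]|exact: cvg_cst].
    by apply/funext => f; rewrite kreB.
  move=> cv; rewrite -(cvg_lim (@Rhausdorff R) cv).
  apply: limr_le; first by apply/cvg_ex; exists (kG k (f0 - val g) u).
  apply: filterS GA => f Af.
  have bfg := kboundedB (kspaceP f) (kspaceP g).
  apply: le_trans (kN_ub u bfg) _; rewrite -sqr_knorm//.
  by rewrite ler_pXn2r ?nnegrE ?knorm_ge0 ?(ltW e0)//; exact: Ae.
have bf0 : kbounded k f0.
  have [A GA Ae] := cauG 1 ltr01; have [g Ag] := filter_ex GA.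
  rewrite -(subrK (val g) f0); apply: kboundedD (kspaceP g).
  by exists (1 ^+ 2) => u; exact: (key _ _ ltr01 GA Ae).
pose F0 := KSpace (introT (asboolP _) bf0 : f0 \in kbounded_pred).
apply/cvg_ex; exists F0; apply/cvg_ballP => e e0.
have eE : e = (complex.Re e)%:C%C by rewrite RRe_real// gtr0_real.
have re0 : 0 < complex.Re e by rewrite -ltcR -eE.
have e20 := divr_gt0 re0 (ltr0Sn R 1).
have [A GA Ae] := cauG _ e20; have kk := key _ _ e20 GA Ae.
apply: filterS GA => g Ag.
rewrite -ball_normE /= kspace_normE eE ltcR raddfB /=.
apply: (@le_lt_trans _ _ (complex.Re e / 2)); last by lra.
have e2 : 0 <= complex.Re e / 2 by lra.
have bfg := kboundedB bf0 (kspaceP g).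
rewrite -(@ler_pXn2r _ 2) ?nnegrE ?knorm_ge0// sqr_knorm//.
by apply: kN_le => u; exact: kk.
Unshelve. all: by end_near.
Qed.
HB.instance Definition _ := Uniform_isComplete.Build kspace kspace_complete.

Definition kspace_inner f g : C := kinner k (val f) (val g).
Lemma kspace_innerPr f g h c :
  kspace_inner f (c *: g + h) = c * kspace_inner f g + kspace_inner f h.
Proof. by rewrite /kspace_inner linearP /= kinnerPr//; exact: kspaceP. Qed.
Lemma kspace_inner_conj f g : kspace_inner g f = (kspace_inner f g)^*.
Proof. by apply: kinner_conj; exact: kspaceP. Qed.
Lemma kspace_inner_norm f : kspace_inner f f = `|f| ^+ 2.
Proof. by apply: kinner_norm; exact: kspaceP. Qed.
HB.instance Definition _ := CompleteNormedModule_isHilbert.Build R kspace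
  kspace_innerPr kspace_inner_conj kspace_inner_norm.

Definition kpoint (x : X) : kspace :=
  KSpace (introT (asboolP _) (kvec_bounded k [:: (1, x)])
    : kvec k [:: (1, x)] \in kbounded_pred).
Lemma inner_kpoint x f : inner (kpoint x) f = val f x.
Proof.
rewrite [LHS]kinner_kvec; last exact: kspaceP.
by rewrite /kev big_seq1 /= conjC1 mul1r.
Qed.
Lemma inner_kpoint2 x y : inner (kpoint x) (kpoint y) = k x y.
Proof. by rewrite inner_kpoint /= /kvec big_seq1 mul1r. Qed.
Lemma kpoint_dense f (e : R) : 0 < e ->
  exists u : seq (C * X), `|f - \sum_(p <- u) p.1 *: kpoint p.2| < e%:C%C.
Proof.
move=> e0; have [u ue] := kvec_dense (kspaceP f) e0; exists u.
rewrite kspace_normE ltcR raddfB /=; suff -> : val (\sum_(p <- u) p.1 *: kpoint p.2) = kvec k u by [].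
rewrite raddf_sum /=; apply/funext => x; rewrite fct_sumE /kvec.
apply: eq_bigr => p _.
by rewrite -[LHS]/(p.1 * _) big_seq1 mul1r.
Qed.
End KernelSpace.

Section InnerTheory.
Context {R : realType} {V : hilbertType R}.
Local Notation C := R[i].
Implicit Types (x y z : V) (c : C).

Lemma inner0r x : inner x 0 = 0.
Proof.
have := innerPr x 0 0 1; rewrite scale1r addr0 mul1r => /eqP.
by rewrite -subr_eq0 opprD addrA subrr sub0r oppr_eq0 => /eqP.
Qed.
Lemma innerDr x y z : inner x (y + z) = inner x y + inner x z.
Proof. by rewrite -[y]scale1r innerPr mul1r scale1r. Qed.
Lemma innerZr c x y : inner x (c *: y) = c * inner x y.
Proof. by rewrite -[c *: y]addr0 innerPr inner0r addr0. Qed.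
Lemma innerNr x y : inner x (- y) = - inner x y.
Proof. by rewrite -scaleN1r innerZr mulN1r. Qed.
Lemma innerBr x y z : inner x (y - z) = inner x y - inner x z.
Proof. by rewrite innerDr innerNr. Qed.
Lemma inner_sumr (I : Type) (s : seq I) (F : I -> V) x :
  inner x (\sum_(i <- s) F i) = \sum_(i <- s) inner x (F i).
Proof.
by elim/big_rec2: _ => [|i a b _ <-]; rewrite ?inner0r ?innerDr.
Qed.
Lemma inner0l x : inner 0 x = 0.
Proof. by rewrite inner_conj inner0r conjC0. Qed.
Lemma innerDl x y z : inner (y + z) x = inner y x + inner z x.
Proof. by rewrite inner_conj innerDr rmorphD /= -!inner_conj. Qed.
Lemma innerZl c x y : inner (c *: y) x = c^* * inner y x.
Proof. by rewrite inner_conj innerZr rmorphM /= -inner_conj. Qed.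
Lemma innerBl x y z : inner (y - z) x = inner y x - inner z x.
Proof. by rewrite inner_conj innerBr rmorphB /= -!inner_conj. Qed.
Lemma inner_suml (I : Type) (s : seq I) (F : I -> V) x :
  inner (\sum_(i <- s) F i) x = \sum_(i <- s) inner (F i) x.
Proof.
by elim/big_rec2: _ => [|i a b _ <-]; rewrite ?inner0l ?innerDl.
Qed.
Lemma inner_ge0 x : 0 <= inner x x.
Proof. by rewrite inner_norm exprn_ge0. Qed.
Lemma inner_eq0 x : (inner x x == 0) = (x == 0).
Proof. by rewrite inner_norm sqrf_eq0 normr_eq0. Qed.

Lemma gram_schmidt (s : seq V) : exists es : seq V,
  (forall i j, (i < size es)%N -> (j < size es)%N ->
     inner (nth 0 es i) (nth 0 es j) = (i == j)%:R) /\
  (forall y, y \in s -> y = \sum_(e <- es) inner e y *: e).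
Proof.
elim: s => [|y s [es [on recon]]]; first by exists [::].
pose r := y - \sum_(e <- es) inner e y *: e.
have er e : e \in es -> inner e r = 0.
  move=> /(nthP 0)[i ilt <-]; rewrite innerBr inner_sumr.
  apply/eqP; rewrite subr_eq0 eq_sym; apply/eqP.
  rewrite (big_nth 0) big_mkord (bigD1 (Ordinal ilt)) //= innerZr on// eqxx mulr1.
  rewrite big1 ?addr0// => j ji; rewrite innerZr on//.
  rewrite (_ : (i == j :> nat) = false) ?mulr0//; apply: contraNF ji.
  by move=> /eqP ij; apply/eqP/val_inj.
have [r0|rn0] := eqVneq r 0.
  exists es; split => // z; rewrite inE => /orP[/eqP ->|/recon//].
  by apply/eqP; rewrite -subr_eq0 -/r r0.
have nr0 : `|r| != 0 by rewrite normr_eq0.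
pose e0 := `|r|^-1 *: r.
have ce : (`|r|^-1 : C)^* = `|r|^-1 by rewrite geC0_conj// invr_ge0.
have e0e e : e \in es -> inner e0 e = 0.
  by move=> ees; rewrite innerZl inner_conj er// conjC0 mulr0.
have e0r : inner e0 r = `|r|.
  by rewrite innerZl ce inner_norm expr2 mulKf.
exists (e0 :: es); split.
  move=> [|i] [|j] /= ilt jlt.
  - by rewrite {2}/e0 innerZr e0r mulVf.
  - by rewrite e0e// mem_nth.
  - by rewrite inner_conj e0e ?conjC0// mem_nth.
  - by rewrite on.
move=> z; rewrite inE big_cons => /orP[/eqP ->|zs].
  have -> : inner e0 y = `|r|.
    have {1}-> : y = r + \sum_(e <- es) inner e y *: e by rewrite subrK.
    rewrite innerDr e0r inner_sumr big_seq big1 ?addr0// => e ees.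
    by rewrite innerZr e0e// mulr0.
  by rewrite scalerA mulfV// scale1r subrK.
suff -> : inner e0 z = 0 by rewrite scale0r add0r; exact: recon.
rewrite (recon z zs) inner_sumr big_seq big1// => e ees.
by rewrite innerZr e0e// mulr0.
Qed.
End InnerTheory.

Section Tensor.
Context {R : realType} (H K : hilbertType R).
Local Notation C := R[i].

Let tker (p q : H * K) : C := inner p.1 q.1 * inner p.2 q.2.
Fact tensor_kernel_herm p q : tker q p = (tker p q)^*.
Proof. by rewrite /tker rmorphM /= -!inner_conj. Qed.
Fact tensor_kernel_ge0 (u : seq (C * (H * K))) :
  0 <= \sum_(p <- u) \sum_(q <- u) (p.1^* * q.1) * tker p.2 q.2.
Proof.
have [es [_ recon]] := gram_schmidt [seq p.2.2 | p <- u].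
rewrite (_ : \sum_(p <- u) _ = \sum_(e <- es)
  inner (\sum_(p <- u) (p.1 * inner e p.2.2) *: p.2.1)
        (\sum_(p <- u) (p.1 * inner e p.2.2) *: p.2.1)); last first.
  under [RHS]eq_bigr do rewrite inner_suml.
  rewrite [RHS]exchange_big /=; apply: eq_bigr => p _.
  under [RHS]eq_bigr do rewrite inner_sumr.
  rewrite [RHS]exchange_big /= big_seq [RHS]big_seq; apply: eq_bigr => q qu.
  rewrite /tker {1}(recon q.2.2 (map_f (fun p => p.2.2) qu)).
  rewrite inner_sumr !mulr_sumr; apply: eq_bigr => e _.
  rewrite innerZl innerZr innerZr rmorphM /= -inner_conj; ring.
by apply: sumr_ge0 => e _; exact: inner_ge0.
Qed.
Definition tensor_kernel : pdkernel R (H * K) :=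
  Kernel tensor_kernel_herm tensor_kernel_ge0.

Definition tensor : hilbertType R := kspace tensor_kernel.
Definition tens (x : H) (y : K) : tensor := kpoint tensor_kernel (x, y).
End Tensor.
Notation "x \ox y" := (tens x y) (at level 40, left associativity).

Section TensorTheory.
Context {R : realType} {H K : hilbertType R}.
Local Notation C := R[i].

Lemma inner_tens (x x' : H) (y y' : K) :
  inner (x \ox y) (x' \ox y') = inner x x' * inner y y'.
Proof. exact: inner_kpoint2. Qed.

Lemma tens_dense (z : tensor H K) (e : R) : 0 < e ->
  exists u : seq (C * (H * K)),
    `|z - \sum_(p <- u) p.1 *: (p.2.1 \ox p.2.2)| < e%:C%C.
Proof.
move=> e0; have [u ue] := kpoint_dense z e0; exists u.
rewrite (eq_bigr (fun p => p.1 *: kpoint (tensor_kernel H K) p.2))//.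
by move=> [c [x y]].
Qed.

Lemma tensPl (c : C) (x x' : H) (y : K) :
  (c *: x + x') \ox y = c *: (x \ox y) + x' \ox y.
Proof.
apply/eqP; rewrite -subr_eq0 -inner_eq0; apply/eqP.
rewrite innerBl !innerBr !innerDl !innerDr !innerZl !innerZr !inner_tens.
rewrite !innerDl !innerDr !innerZl !innerZr; ring.
Qed.
Lemma tensPr (c : C) (x : H) (y y' : K) :
  x \ox (c *: y + y') = c *: (x \ox y) + x \ox y'.
Proof.
apply/eqP; rewrite -subr_eq0 -inner_eq0; apply/eqP.
rewrite innerBl !innerBr !innerDl !innerDr !innerZl !innerZr !inner_tens.
rewrite !innerDl !innerDr !innerZl !innerZr; ring.
Qed.
End TensorTheory.

Section BoundedOperators.
Context {R : realType}.
Local Notation C := R[i].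

Record bop (H K : hilbertType R) := Bop {
  bop_linear :> {linear H -> K} ;
  bop_continuous : continuous bop_linear }.

HB.instance Definition _ H K := gen_eqMixin (bop H K).
HB.instance Definition _ H K := gen_choiceMixin (bop H K).

Definition bop0 (H K : hilbertType R) : bop H K :=
  @Bop H K (GRing.null_fun K) (fun=> @cvg_cst _ _ _ _ _).
Definition idop (H : hilbertType R) : bop H H :=
  @Bop H H (@idfun H) (fun x => @cvg_id _ (nbhs x)).

(* By Riesz representation exactly one bounded operator satisfies the defining
   identity, so the default value [bop0] is never used. *)
Definition adjoint (H K : hilbertType R) (A : bop H K) : bop K H :=
  xget (bop0 K H) [set B | forall x y, inner (B y) x = inner y (A x)].

Definition contraction (H K : hilbertType R) (A : bop H K) : Prop :=
  forall x, `|A x| <= `|x|.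

Definition unitary_op (H K : hilbertType R) (A : bop H K) : Prop :=
  adjoint A \o A =1 id /\ A \o adjoint A =1 id.

(* The order of [R[i]] only compares numbers with the same imaginary part, so
   this says that [B - A] is a positive operator. *)
Definition op_le (H : hilbertType R) (A B : bop H H) : Prop :=
  forall h, inner h (A h) <= inner h (B h).

(* The operators below are determined on elementary tensors, whose span is
   dense; such bounded operators exist, so [bop0] is never used. *)
Definition tensop (H H' K K' : hilbertType R) (A : bop H H') (B : bop K K') :
    bop (tensor H K) (tensor H' K') :=
  xget (bop0 _ _) [set D | forall x y, D (x \ox y) = A x \ox B y].

Definition tassoc (H K L : hilbertType R) :
    bop (tensor (tensor H K) L) (tensor H (tensor K L)) :=
  xget (bop0 _ _) [set D | forall x y z, D (x \ox y \ox z) = x \ox (y \ox z)].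
Definition tassocV (H K L : hilbertType R) :
    bop (tensor H (tensor K L)) (tensor (tensor H K) L) :=
  xget (bop0 _ _) [set D | forall x y z, D (x \ox (y \ox z)) = x \ox y \ox z].

Definition separable_space (V : hilbertType R) : Prop :=
  exists D : set V, countable D /\ dense D.

Definition orthonormal_basis (V : hilbertType R) (J : choiceType) (e : J -> V) :=
  (forall a b, inner (e a) (e b) = (a == b)%:R) /\
  dense [set x | exists s : seq (C * J), x = \sum_(p <- s) p.1 *: e p.2].

(* Unordered sums: convergence of the net of finite partial sums. *)
Definition has_sum (V : hilbertType R) (J : choiceType) (f : J -> V) (x : V) :=
  partial_sum f @ totally --> x.

Definition sot_sum (H K : hilbertType R) (J : choiceType)
    (F : J -> H -> K) (A : H -> K) : Prop :=
  forall h, has_sum (fun a => F a h) (A h).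

End BoundedOperators.

Notation "A \otimes B" := (tensop A B) (at level 40, left associativity).

Section Twisted.
Context {R : realType}.
Local Notation C := R[i].

Record product_system (k : nat) := ProductSystem {
  fiber :> 'I_k -> hilbertType R ;
  flip : forall i j, bop (tensor (fiber i) (fiber j)) (tensor (fiber j) (fiber i)) ;
  flip_unitary : forall i j, unitary_op (flip i j) ;
  flipK : forall i j, cancel (flip i j) (flip j i) ;
  flip_id : forall i, flip i i =1 id ;
  flip_hexagon : forall i j l, i != j -> i != l -> j != l ->
    (idop (fiber l) \otimes flip i j) \o tassoc _ _ _ \o
      (flip i l \otimes idop (fiber j)) \o tassocV _ _ _ \o
      (idop (fiber i) \otimes flip j l) =1
    tassoc _ _ _ \o (flip j l \otimes idop (fiber i)) \o tassocV _ _ _ \o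
      (idop (fiber j) \otimes flip i l) \o tassoc _ _ _ \o
      (flip i j \otimes idop (fiber l)) \o tassocV _ _ _ }.

(* [T] is completely contractive for the column operator space structure of
   [F] if and only if the induced map on the Hilbert tensor product is a
   contraction. *)
Definition completely_contractive (F H : hilbertType R) (T : F -> bop H H) :=
  exists2 A : bop (tensor F H) H,
    (forall xi h, A (xi \ox h) = T xi h) & contraction A.

(* Only meaningful when [T] is completely contractive (more generally, when the
   induced map is bounded). *)
Definition tilde (F H : hilbertType R) (T : F -> bop H H) : bop (tensor F H) H :=
  xget (bop0 _ _) [set A | forall xi h, A (xi \ox h) = T xi h].

Definition linear_family (F H : hilbertType R) (T : F -> bop H H) : Prop :=
  forall (c : C) xi eta h, T (c *: xi + eta) h = c *: T xi h + T eta h.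

Section Representation.
Context (k : nat) (E : product_system k) (H : hilbertType R).
Variables (T : forall i, E i -> bop H H) (U : 'I_k -> 'I_k -> bop H H).
Local Notation "T~ i" := (tilde (@T i)) (at level 8, i at level 2).

(* The coefficient algebra is [C], acting on the fibers and on [H] by scalars:
   [sigma] carries no data and its covariance is the linearity of [T]. *)
Record twisted_rep : Prop := TwistedRep {
  twisted_linear : forall i, linear_family (@T i) ;
  twisted_contractive : forall i, completely_contractive (@T i) ;
  twisted_unitary : forall i j, i != j -> unitary_op (U i j) ;
  twisted_adjoint : forall i j, i != j -> U j i =1 adjoint (U i j) ;
  twisted_commute : forall i j l, i != j ->
    U i j \o T~ l =1 T~ l \o (idop (E l) \otimes U i j) ;
  twisted_flip : forall i j, i != j ->
    T~ i \o (idop (E i) \otimes T~ j) \o tassoc _ _ _ =1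
    T~ j \o (idop (E j) \otimes T~ i) \o tassoc _ _ _ \o
      (flip E i j \otimes U i j) }.

Definition doubly_twisted_rep : Prop := twisted_rep /\
  forall i j, i != j ->
    adjoint T~ j \o T~ i =1
    (idop (E j) \otimes T~ i) \o tassoc _ _ _ \o (flip E i j \otimes U i j) \o
      tassocV _ _ _ \o (idop (E i) \otimes adjoint T~ j).

Context (J : 'I_k -> choiceType) (e : forall i, J i -> E i).
Variable S : forall i, J i -> bop H H.

Definition coordinate_expansion : Prop := forall i xi h,
  has_sum (fun a => inner (e a) xi *: @S i a h) (T xi h).

Definition row_contractive : Prop := forall i,
  exists2 P : bop H H,
    sot_sum (fun a h => @S i a (adjoint (@S i a) h)) P & op_le P (idop H).

Definition coordinate_twisted : Prop := forall i j, i != j ->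
  forall (a : J i) (b : J j),
  sot_sum
    (fun (p : J j * J i) h =>
       inner (e p.1 \ox e p.2) (flip E i j (e a \ox e b)) *:
         S p.1 (S p.2 (U i j h)))
    (S a \o S b).

(* Iterated sum: [X c] is the sum over [d] for fixed [c]. *)
Definition coordinate_doubly_twisted : Prop := forall i j, i != j ->
  forall (a : J i) (b : J j),
  exists2 X : J j -> bop H H,
    (forall c, sot_sum
       (fun (d : J i) h =>
          inner (e b \ox e d) (flip E i j (e a \ox e c)) *:
            S d (U i j (adjoint (S c) h)))
       (X c)) &
    sot_sum (fun c => X c) (adjoint (S b) \o S a).

End Representation.
End Twisted.
Arguments product_system : clear implicits.

(* Main.v *)
Require Import Defs.
From HB Require Import structures.
From mathcomp Require Import all_boot all_order all_algebra finmap complex.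
From mathcomp Require Import all_classical all_reals all_analysis.
From mathcomp.analysis Require Import showcase.summability.
From mathcomp Require Import ring lra.
Set Implicit Arguments. Unset Strict Implicit. Unset Printing Implicit Defensive.
Import Order.TTheory GRing.Theory Num.Theory.
Import numFieldNormedType.Exports.
Local Open Scope classical_set_scope.
Local Open Scope ring_scope.

(* For a basis vector [e a] of a fiber [F], let [slice (e a)] be the adjoint of
   [h |-> e a \ox h].  The projections [e a \ox slice (e a) v] sum to [v], so an
   operator on [F (x) H] is determined by its slices, and with [S a = T (e a)] the
   slices of [T~* h] are the vectors [(S a)* h].  Hence [T~ T~*] is the sum of the
   [S a (S a)*], and conversely the row condition bounds the finite sums of the
   [S a o slice (e a)] by 1, which makes [T] completely contractive.  The two
   commutation relations are identities between bounded operators: the first is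
   tested on the total family [e a \ox e b \ox h], the second on [e a \ox h] after
   slicing along [e b]. *)

(** * Cauchy-Schwarz and separation of vectors *)

Section InnerProduct.
Context {R : realType} {V : hilbertType R}.
Local Notation C := R[i].
Implicit Types (x y z : V) (c : C).

Lemma cauchy_schwarz x y : `|inner x y| <= `|x| * `|y|.
Proof.
have [->|x0] := eqVneq x 0; first by rewrite inner0l !normr0 mul0r.
have nx0 : 0 < `|x| by rewrite normr_gt0.
pose c := inner x y / `|x| ^+ 2.
have xz : inner x (y - c *: x) = 0.
  by rewrite innerBr innerZr inner_norm /c divfK ?subrr// expf_neq0// normr_eq0.
have : 0 <= inner (y - c *: x) (y - c *: x) by exact: inner_ge0.
rewrite innerBl innerZl xz mulr0 subr0 innerBr innerZr inner_norm subr_ge0.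
rewrite (inner_conj x y) /c mulrAC -normCK ler_pdivrMr ?exprn_gt0//.
by rewrite mulrC -exprMn ler_pXn2r// nnegrE// mulr_ge0.
Qed.

Lemma inner_injl x y : (forall z, inner x z = inner y z) -> x = y.
Proof.
move=> xy; apply/eqP; rewrite -subr_eq0 -inner_eq0 innerBl xy subrr//.
Qed.

Lemma inner_injr x y : (forall z, inner z x = inner z y) -> x = y.
Proof.
move=> xy; apply: inner_injl => z.
by rewrite inner_conj xy -inner_conj.
Qed.

Lemma normr_Re (x : V) : `|x| = (complex.Re `|x|)%:C%C.
Proof. by rewrite RRe_real// ger0_real. Qed.

Lemma gt0_Re (c : C) : 0 < c -> c = (complex.Re c)%:C%C /\ 0 < complex.Re c.
Proof.
move=> c0; have cE : (complex.Re c)%:C%C = c by rewrite RRe_real// gtr0_real.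
by split => //; rewrite -ltcR cE.
Qed.

Lemma norm_le_eps_eq x y : (forall eps : C, 0 < eps -> `|x - y| <= eps) -> x = y.
Proof.
move=> xy; apply/eqP; rewrite -subr_eq0 -normr_eq0; apply/negPn/negP => n0.
have p : 0 < `|x - y| by rewrite lt_neqAle eq_sym n0 normr_ge0.
have /xy : 0 < `|x - y| / 2 by rewrite divr_gt0.
by rewrite ler_pdivlMr// mulr_natr mulr2n gerDl => /le_gtF; rewrite p.
Qed.
End InnerProduct.

(** * Bounded operators and their norm bounds *)

Section BoundedOperatorNorm.
Context {R : realType}.
Local Notation C := R[i].
Implicit Types H K : hilbertType R.

Lemma bop_bounded H K (A : bop H K) :
  exists2 M : C, 0 < M & forall x, `|A x| <= M * `|x|.
Proof.
have /linear_boundedP [M [Mr MP]] :=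
  (linear_bounded_continuous (bop_linear A)).2 (bop_continuous (b := A)).
(* The bound is available for every constant strictly above [M]; [|M| + 1] is one, and it is
   positive. *)
have M0 : 0 < `|M| + 1 by rewrite ltr_wpDl.
exists (`|M| + 1) => //; apply: MP.
by rewrite (le_lt_trans (real_ler_norm Mr))// ltrDl.
Qed.

Lemma bop_exists H K (f : H -> K) (M : C) : linear f ->
  (forall x, `|f x| <= M * `|x|) -> exists A : bop H K, forall x, A x = f x.
Proof.
move=> lf bf.
pose f' : {linear H -> K} := HB.pack f (GRing.isLinear.Build _ _ _ _ f lf).
have cf : continuous f'.
  apply/linear_bounded_continuous/linear_boundedP.
  exists `|M|; split => // r Mr x; apply: le_trans (bf x) _.
  (* [M] is any complex number, but [M * |x|] dominates a norm, hence is real and at most its own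
     modulus. *)
  have /real_ler_norm h : M * `|x| \is Num.real.
    by rewrite ger0_real// (le_trans _ (bf x)).
  by apply: le_trans h _; rewrite normrM normr_id ler_wpM2r// ltW.
by exists (Bop cf).
Qed.

Lemma bcomp_continuous H K L (A : bop K L) (B : bop H K) :
  continuous ((bop_linear A \o bop_linear B) : {linear H -> L}).
Proof.
move=> x; apply: continuous_comp; exact: bop_continuous.
Qed.
Definition bcomp H K L (A : bop K L) (B : bop H K) : bop H L :=
  Bop (@bcomp_continuous H K L A B).
Lemma bcompE H K L (A : bop K L) (B : bop H K) x : bcomp A B x = A (B x).
Proof. by []. Qed.

End BoundedOperatorNorm.

(** * Riesz representation, adjoints, and extension of operators from a family of vectors *)

Section AdjointsAndExtensions.
Context {R : realType}.
Local Notation C := R[i].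

(** The preimages of small balls around [z] generate a Cauchy filter because [f] preserves
    distances; its limit in the complete space [H] is sent to [z]. *)
Lemma isometry_dense_surj (H K : hilbertType R) (f : H -> K) :
  (forall x y, `|f x - f y| = `|x - y|) ->
  (forall z (eps : R), 0 < eps -> exists y, `|z - f y| < eps%:C%C) ->
  forall z, exists y, f y = z.
Proof.
move=> isof densef z.
pose B (eps : R) := [set y | `|z - f y| < eps%:C%C].
pose G := filter_from [set eps : R | 0 < eps] B.
have FG : ProperFilter G.
  apply: filter_from_proper => [|eps e0]; last first.
    by have [y] := densef z _ e0; exists y.
  apply: filter_from_filter; first by exists 1 => /=.
  move=> a b a0 b0; exists (Num.min a b) => /=; first by rewrite lt_min a0.
  move=> y; rewrite /B /= => yab; split; apply: (lt_le_trans yab).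
    by rewrite lecR ge_min lexx.
  by rewrite lecR ge_min lexx orbT.
have cG : cauchy G.
  apply: cauchy_exP => eps /gt0_Re[-> e0].
  have e20 : 0 < complex.Re eps / 2 by rewrite divr_gt0.
  have [x xz] := densef z _ e20; exists x.
  exists (complex.Re eps / 2) => // y yz; rewrite -ball_normE /=.
  rewrite -isof (le_lt_trans (ler_distD z _ _))//.
  rewrite [complex.Re eps]splitr rmorphD /= ltrD//.
  by rewrite distrC.
have cvG : G --> lim G by exact: cauchy_cvg.
have /cvgrPdist_lt cv : id x @[x --> G] --> lim G by exact: cvG.
exists (lim G); apply: norm_le_eps_eq => eps e0.
have e20 : 0 < eps / 2 by rewrite divr_gt0.
have [e2E e2R] := gt0_Re e20.
have GB : G (B (complex.Re (eps / 2))) by exists (complex.Re (eps / 2)).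
have [y [yB yl]] := filter_ex (filterI GB (cv _ e20)); apply/ltW.
have {}yB : `|z - f y| < eps / 2 by rewrite e2E.
rewrite (le_lt_trans (ler_distD (f y) _ _))// isof [eps]splitr ltrD//.
by rewrite distrC.
Qed.

Section GramKernel.
Context {H : hilbertType R} {X : Type} (p : X -> H).

Fact gram_herm x y : inner (p y) (p x) = (inner (p x) (p y))^*.
Proof. exact: inner_conj. Qed.
Fact gram_ge0 (u : seq (C * X)) :
  0 <= \sum_(a <- u) \sum_(b <- u) (a.1^* * b.1) * inner (p a.2) (p b.2).
Proof.
have := inner_ge0 (\sum_(a <- u) a.1 *: p a.2); rewrite inner_suml.
congr (0 <= _); apply: eq_bigr => a _; rewrite inner_sumr.
by apply: eq_bigr => b _; rewrite innerZl innerZr mulrA.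
Qed.
(** Its [kspace] is a copy of the closed span of the vectors [p x], with [kpoint _ x] in the place
    of [p x]. *)
Definition gram_kernel : pdkernel R X := Defs.Kernel gram_herm gram_ge0.

Lemma kq_gram (u : seq (C * X)) :
  (kq gram_kernel u)%:C%C = `|\sum_(a <- u) a.1 *: p a.2| ^+ 2.
Proof.
have kE : kev (kvec gram_kernel u) u = inner (\sum_(a <- u) a.1 *: p a.2)
    (\sum_(a <- u) a.1 *: p a.2).
  rewrite /kev inner_suml; apply: eq_bigr => a _; rewrite inner_sumr mulr_sumr.
  by apply: eq_bigr => b _; rewrite innerZl innerZr.
by rewrite /kq kE inner_norm RRe_real// ger0_real// exprn_ge0.
Qed.

(* Completing the square, [2 Re a - b^2 <= M^2] as soon as [|a| <= M b]. *)
Lemma gram_member (g : X -> C^o) (M : R) : 0 <= M ->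
  (forall u, `|kev g u| <= M%:C%C * `|\sum_(a <- u) a.1 *: p a.2|) ->
  exists F : kspace gram_kernel, val F = g /\ `|F| <= M%:C%C.
Proof.
move=> M0 gM.
have ub u : kG gram_kernel g u <= M ^+ 2.
  have := gM u; have := kq_gram u; rewrite normr_Re.
  set b := complex.Re _; rewrite -rmorphXn /= => /complexI.
  rewrite -rmorphM /= /kG => -> ab.
  have : `|kre g u|%:C%C <= (M * b)%:C%C := le_trans (normc_ge_Re _) ab.
  rewrite lecR => /(le_trans (ler_norm _)) rb.
  have := sqr_ge0 (M - b); rewrite sqrrB; lra.
have bg : kbounded gram_kernel g by exists (M ^+ 2).
exists (KSpace (introT (asboolP _) bg : g \in kbounded_pred _)); split => //.
rewrite kspace_normE lecR /= -(ger0_norm M0) -sqrtr_sqr ler_wsqrtr//.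
exact: kN_le.
Qed.
End GramKernel.

(* [H] embeds isometrically and densely, hence onto, in the reproducing kernel
   space of its own inner product, which contains the conjugate of [phi]. *)
Lemma riesz (H : hilbertType R) (phi : H -> C) (M : C) :
  (forall c x y, phi (c *: x + y) = c * phi x + phi y) ->
  (forall x, `|phi x| <= M * `|x|) -> exists y, forall x, phi x = inner y x.
Proof.
move=> lphi bphi.
pose k : pdkernel R H := gram_kernel (fun x : H => x).
have phi0 : phi 0 = 0.
  have := lphi 1 0 0; rewrite scale1r addr0 mul1r => /eqP.
  by rewrite -[X in X == _]addr0 (inj_eq (addrI _)) eq_sym => /eqP.
have phi_sum (u : seq (C * H)) :
    phi (\sum_(a <- u) a.1 *: a.2) = \sum_(a <- u) a.1 * phi a.2.
  by elim/big_rec2: _ => [//|a s t _ <-]; rewrite lphi.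
have [||F [FE _]] := @gram_member H H id (fun x => (phi x)^*) (complex.Re `|M|).
- by apply: ge0_Re.
- move=> u; rewrite RRe_real ?ger0_real//.
  apply: le_trans (_ : `|M * `|\sum_(a <- u) a.1 *: a.2| | <= _); last first.
    by rewrite normrM normr_id.
  have h := bphi (\sum_(a <- u) a.1 *: a.2).
  rewrite (ger0_norm (le_trans _ h))//; apply: le_trans h.
  rewrite -[X in _ <= X]norm_conjC phi_sum rmorph_sum.
  rewrite /kev le_eqVlt; apply/orP; left; apply/eqP; congr `|_|.
  by apply: eq_bigr => a _; rewrite rmorphM.
have kpE x z : val (kpoint k x) z = inner z x by rewrite /= /kvec big_seq1 mul1r.
have kpP c x y : kpoint k (c *: x + y) = c *: kpoint k x + kpoint k y.
  apply/val_inj/funext => z; by rewrite kpE innerPr linearP -!kpE.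
have kp_sum (u : seq (C * H)) :
    \sum_(a <- u) a.1 *: kpoint k a.2 = kpoint k (\sum_(a <- u) a.1 *: a.2).
  elim/big_rec2: _ => [|a s t _ ->]; last by rewrite kpP.
  by apply/val_inj/funext => z; rewrite kpE inner0r.
have [x y|f eps e0|y yF] := @isometry_dense_surj H (kspace k) (kpoint k) _ _ F.
- have -> : kpoint k x - kpoint k y = kpoint k (x - y).
    by rewrite -scaleN1r addrC -kpP scaleN1r addrC.
  apply/eqP; rewrite -(@eqrXn2 _ 2)//; apply/eqP.
  by rewrite -!inner_norm inner_kpoint2.
- have [u uP] := kpoint_dense f e0.
  by exists (\sum_(a <- u) a.1 *: a.2); rewrite -kp_sum.
exists y => x; apply: (can_inj conjCK); rewrite -inner_conj -kpE yF.
by rewrite FE.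
Qed.

Section Adjoint.
Implicit Types H K L : hilbertType R.

(** Riesz representation of [x |-> inner y (A x)] for each [y] yields a bounded operator, so the
    choice in [adjoint] never falls back on [bop0]. *)
Lemma adjointP H K (A : bop H K) x y : inner (adjoint A y) x = inner y (A x).
Proof.
suff [B BP] : exists B : bop K H, forall x y, inner (B y) x = inner y (A x).
  by rewrite /adjoint; case: xgetP => [D _ ->//|/(_ B)].
have [M M0 MP] := bop_bounded A.
have /choice [f fP] : forall y, exists z, forall x, inner y (A x) = inner z x.
  move=> y0; apply: (@riesz H _ (`|y0| * M)) => [c x1 x2|x1].
    by rewrite linearP innerPr.
  by rewrite (le_trans (cauchy_schwarz _ _))// -mulrA ler_wpM2l.
have [||B BE] := @bop_exists R _ _ f M.
- move=> c y1 y2; apply: inner_injl => z.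
  by rewrite -fP innerDl innerZl !fP innerDl innerZl.
- move=> z; have [->|fz0] := eqVneq (f z) 0.
    by rewrite normr0 mulr_ge0// ltW.
  rewrite -(ler_pM2r (_ : 0 < `|f z|)) ?normr_gt0// -expr2 -inner_norm -fP.
  rewrite -[inner _ _]ger0_norm; last by rewrite fP inner_ge0.
  rewrite (le_trans (cauchy_schwarz _ _))// mulrAC mulrC ler_wpM2r//.
by exists B => x1 y1; rewrite BE.
Qed.

Lemma adjointPr H K (A : bop H K) x y : inner x (adjoint A y) = inner (A x) y.
Proof. by rewrite inner_conj adjointP -inner_conj. Qed.

Lemma adjoint_unique H K (A : bop H K) (B : K -> H) :
  (forall x y, inner x (B y) = inner (A x) y) -> adjoint A =1 B.
Proof. by move=> AB y; apply: inner_injr => x; rewrite AB adjointPr. Qed.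

Lemma adjoint_comp H K L (A : bop K L) (B : bop H K) (D : bop H L) :
  D =1 A \o B -> adjoint D =1 adjoint B \o adjoint A.
Proof.
by move=> DAB; apply: adjoint_unique => x y /=; rewrite !adjointPr DAB.
Qed.

(** With [z = adjoint A y], the square of the norm of [z] is [inner y (A z)], which Cauchy-Schwarz
    bounds by [|y| * M * |z|]; then [|z|] is cancelled. *)
Lemma adjoint_bound H K (A : bop H K) (M : C) : 0 <= M ->
  (forall x, `|A x| <= M * `|x|) -> forall y, `|adjoint A y| <= M * `|y|.
Proof.
move=> M0 AM y; have [->|fz0] := eqVneq (adjoint A y) 0.
  by rewrite normr0 mulr_ge0.
rewrite -(ler_pM2r (_ : 0 < `|adjoint A y|)) ?normr_gt0// -expr2 -inner_norm.
rewrite adjointP -[inner _ _]ger0_norm; last by rewrite -adjointP inner_ge0.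
by rewrite (le_trans (cauchy_schwarz _ _))// mulrAC mulrC ler_wpM2r.
Qed.
End Adjoint.

Section Extension.
Context {X : Type}.
Implicit Types H K : hilbertType R.

(** Instead of extending by continuity, one takes the adjoint of the map sending [y] to the function
    [x |-> inner (q x) y]; [gram_member] places that function in the space with norm at most
    [M * |y|]. *)
Lemma gram_realize H K (p : X -> H) (q : X -> K) (M : R) : 0 <= M ->
  (forall u : seq (C * X), `|\sum_(a <- u) a.1 *: q a.2|
     <= M%:C%C * `|\sum_(a <- u) a.1 *: p a.2|) ->
  exists A : bop (kspace (gram_kernel p)) K,
    (forall x, A (kpoint _ x) = q x) /\ forall f, `|A f| <= M%:C%C * `|f|.
Proof.
move=> M0 pq.
have /choice [f fP] : forall y, exists F : kspace (gram_kernel p),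
    val F = (fun x => inner (q x) y) /\ `|F| <= M%:C%C * `|y|.
  move=> y; have [|u|F [FE Fb]] := @gram_member H X p (fun x => inner (q x) y)
     (M * complex.Re `|y|); last first.
  - by exists F; split => //; move: Fb; rewrite rmorphM /= -normr_Re.
  - rewrite rmorphM /= -normr_Re.
    have -> : kev (fun x => inner (q x) y) u = inner (\sum_(a <- u) a.1 *: q a.2) y.
      by rewrite inner_suml; apply: eq_bigr => a _; rewrite innerZl.
    by rewrite (le_trans (cauchy_schwarz _ _))// mulrAC ler_wpM2r.
  - by rewrite mulr_ge0// ge0_Re.
have vf x y : val (f y) x = inner (q x) y by rewrite (fP y).1.
have [||B BE] := @bop_exists R _ _ f M%:C%C.
- move=> c y1 y2; apply/val_inj/funext => x.
  by rewrite linearP vf innerPr -!vf.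
- by move=> y; exact: (fP y).2.
have BM y : `|B y| <= M%:C%C * `|y| by rewrite BE; exact: (fP y).2.
exists (adjoint B); split => [x|F]; last by apply: adjoint_bound; rewrite ?lecR.
by apply: inner_injl => y; rewrite adjointP BE inner_kpoint vf.
Qed.

(* Both families are realised by bounded operators [P], [Q] on the reproducing
   kernel space of the Gram kernel of [p]; as [P] is isometric, [Q P*] sends
   [p x] to [q x]. *)
Lemma bop_extend H K (p : X -> H) (q : X -> K) (M : R) : 0 <= M ->
  (forall u : seq (C * X), `|\sum_(a <- u) a.1 *: q a.2|
     <= M%:C%C * `|\sum_(a <- u) a.1 *: p a.2|) ->
  exists A : bop H K, (forall x, A (p x) = q x) /\ forall v, `|A v| <= M%:C%C * `|v|.
Proof.
move=> M0 /(gram_realize M0) [Q [Qk Qb]].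
have [|u|P [Pk Pb]] := @gram_realize H H p p 1 => //; first by rewrite mul1r.
exists (bcomp Q (adjoint P)); split => [x|v] /=; last first.
  rewrite (le_trans (Qb _))// ler_wpM2l ?lecR// (le_trans (adjoint_bound _ Pb _))//.
  by rewrite mul1r.
rewrite -Qk; congr (Q _); apply/val_inj/funext => y.
by rewrite -!inner_kpoint adjointPr !Pk inner_kpoint2.
Qed.
End Extension.
End AdjointsAndExtensions.

(** * Tensor products of operators, associators and induced maps *)

Section TensorOperators.
Context {R : realType}.
Local Notation C := R[i].
Implicit Types H K L : hilbertType R.

Lemma tens_norm H K (x : H) (y : K) : `|x \ox y| = `|x| * `|y|.
Proof.
apply/eqP; rewrite -(@eqrXn2 _ 2) ?mulr_ge0//; apply/eqP.
by rewrite exprMn -!inner_norm inner_tens.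
Qed.

Lemma tensl_exists H K (x : H) :
  exists A : bop K (tensor H K), forall y, A y = x \ox y.
Proof.
apply: (@bop_exists R _ _ _ `|x|) => [c y z|y]; first by rewrite tensPr.
by rewrite tens_norm.
Qed.
Definition tensl H K (x : H) : bop K (tensor H K) := projT1 (cid (tensl_exists K x)).
Lemma tenslE H K (x : H) (y : K) : tensl K x y = x \ox y.
Proof. by rewrite /tensl; case: cid. Qed.

Lemma tensr_exists H K (y : K) :
  exists A : bop H (tensor H K), forall x, A x = x \ox y.
Proof.
apply: (@bop_exists R _ _ _ `|y|) => [c x z|x]; first by rewrite tensPl.
by rewrite tens_norm mulrC.
Qed.
Definition tensr H K (y : K) : bop H (tensor H K) := projT1 (cid (tensr_exists H y)).
Lemma tensrE H K (x : H) (y : K) : tensr H y x = x \ox y.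
Proof. by rewrite /tensr; case: cid. Qed.

Lemma tensZl H K (c : C) (x : H) (y : K) : (c *: x) \ox y = c *: (x \ox y).
Proof. by rewrite -!tensrE linearZ. Qed.
Lemma tensZr H K (c : C) (x : H) (y : K) : x \ox (c *: y) = c *: (x \ox y).
Proof. by rewrite -!tenslE linearZ. Qed.

Lemma isometric_norm (X : Type) H K (p : X -> H) (q : X -> K) (u : seq (C * X)) :
  (forall x y, inner (p x) (p y) = inner (q x) (q y)) ->
  `|\sum_(a <- u) a.1 *: p a.2| = `|\sum_(a <- u) a.1 *: q a.2|.
Proof.
move=> pq; apply/eqP; rewrite -(@eqrXn2 _ 2)//; apply/eqP.
rewrite -!inner_norm !inner_suml; apply: eq_bigr => a _; rewrite !inner_sumr.
by apply: eq_bigr => b _; rewrite !innerZl !innerZr pq.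
Qed.

(** Norms of linear combinations depend only on the Gram matrix, so [bop_extend] applies with
    constant 1. The swap and both associators arise in this way. *)
Lemma bop_isometric (X : Type) H K (p : X -> H) (q : X -> K) :
  (forall x y, inner (p x) (p y) = inner (q x) (q y)) ->
  exists A : bop H K, forall x, A (p x) = q x.
Proof.
move=> pq; have [//|u|A [AE _]] := @bop_extend R X H K p q 1; last by exists A.
by rewrite mul1r (isometric_norm _ pq).
Qed.

(** Parseval in the second factor: expanding one second component of each inner product along [es]
    splits the squared norm into those of the coordinate vectors. *)
Lemma tens_sum_norm H H' K (f : H -> H') (u : seq (C * (H * K))) (es : seq K) :
  (forall y, y \in [seq a.2.2 | a <- u] -> y = \sum_(e <- es) inner e y *: e) ->
  `|\sum_(a <- u) a.1 *: (f a.2.1 \ox a.2.2)| ^+ 2 =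
  \sum_(e <- es) `|\sum_(a <- u) (a.1 * inner e a.2.2) *: f a.2.1| ^+ 2.
Proof.
move=> recon; rewrite -inner_norm inner_suml.
under [RHS]eq_bigr do rewrite -inner_norm inner_suml.
rewrite [RHS]exchange_big /=; apply: eq_bigr => p _; rewrite inner_sumr.
under [RHS]eq_bigr do rewrite inner_sumr.
rewrite [RHS]exchange_big /= big_seq [RHS]big_seq; apply: eq_bigr => q qu.
rewrite innerZl innerZr inner_tens.
rewrite {1}(recon q.2.2 (map_f (fun p => p.2.2) qu)).
rewrite inner_sumr !mulr_sumr; apply: eq_bigr => e _.
rewrite innerZl innerZr innerZr rmorphM /= -inner_conj; ring.
Qed.

(** With Gram-Schmidt coordinates in the second factor, [A] acts on each coordinate vector
    separately, so its bound [M] carries over to the tensor product. *)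
Lemma tensop_idr_exists H H' K (A : bop H H') :
  exists D : bop (tensor H K) (tensor H' K), forall x y, D (x \ox y) = A x \ox y.
Proof.
have [M M_gt0 AM] := bop_bounded A; have [ME /ltW M0] := gt0_Re M_gt0.
have [u|D [DE _]] := @bop_extend R (H * K) (tensor H K) (tensor H' K)
  (fun p => p.1 \ox p.2) (fun p => A p.1 \ox p.2) _ M0; last first.
  by exists D => x y; exact: (DE (x, y)).
have [es [_ recon]] := gram_schmidt [seq a.2.2 | a <- u].
rewrite -ME -(@ler_pXn2r _ 2) ?nnegrE ?mulr_ge0 ?(ltW M_gt0)// exprMn.
rewrite (tens_sum_norm A recon) (tens_sum_norm id recon) mulr_sumr.
apply: ler_sum => e _; rewrite -exprMn ler_pXn2r ?nnegrE ?mulr_ge0 ?(ltW M_gt0)//.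
have -> : \sum_(a <- u) (a.1 * inner e a.2.2) *: A a.2.1 =
    A (\sum_(a <- u) (a.1 * inner e a.2.2) *: a.2.1).
  by rewrite linear_sum; apply: eq_bigr => a _; rewrite linearZ.
by have := AM (\sum_(a <- u) (a.1 * inner e a.2.2) *: a.2.1).
Qed.

Lemma tens_swap_exists H K :
  exists D : bop (tensor H K) (tensor K H), forall x y, D (x \ox y) = y \ox x.
Proof.
have [p q|D DE] := @bop_isometric (H * K) _ _
  (fun p => p.1 \ox p.2) (fun p => p.2 \ox p.1).
  by rewrite !inner_tens mulrC.
by exists D => x y; exact: (DE (x, y)).
Qed.

Lemma tensopE H H' K K' (A : bop H H') (B : bop K K') x y :
  (A \otimes B) (x \ox y) = A x \ox B y.
Proof.
suff [D DE] : exists D : bop (tensor H K) (tensor H' K'),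
    forall x y, D (x \ox y) = A x \ox B y.
  by rewrite /tensop; case: xgetP => [E _ ->//|/(_ D)].
have [D1 D1E] := tensop_idr_exists K A; have [s sE] := tens_swap_exists H' K.
have [D2 D2E] := tensop_idr_exists H' B; have [t tE] := tens_swap_exists K' H'.
(* The second factor is reached by swapping, applying [B] on the left, and swapping back. *)
exists (bcomp t (bcomp D2 (bcomp s D1))) => x1 y1 /=.
by rewrite D1E sE D2E tE.
Qed.

Lemma tassocE H K L (x : H) (y : K) (z : L) :
  tassoc H K L (x \ox y \ox z) = x \ox (y \ox z).
Proof.
have [p q|D DE] := @bop_isometric (H * K * L) _ _
  (fun p => p.1.1 \ox p.1.2 \ox p.2) (fun p => p.1.1 \ox (p.1.2 \ox p.2)).
  by rewrite !inner_tens mulrA.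
rewrite /tassoc; case: xgetP => [E _ ->//|/(_ D)[]] x1 y1 z1.
exact: (DE (x1, y1, z1)).
Qed.

Lemma tassocVE H K L (x : H) (y : K) (z : L) :
  tassocV H K L (x \ox (y \ox z)) = x \ox y \ox z.
Proof.
have [p q|D DE] := @bop_isometric (H * K * L) _ _
  (fun p => p.1.1 \ox (p.1.2 \ox p.2)) (fun p => p.1.1 \ox p.1.2 \ox p.2).
  by rewrite !inner_tens mulrA.
rewrite /tassocV; case: xgetP => [E _ ->//|/(_ D)[]] x1 y1 z1.
exact: (DE (x1, y1, z1)).
Qed.

Lemma tildeE (F H : hilbertType R) (T : F -> bop H H) :
  completely_contractive T -> forall xi h, tilde T (xi \ox h) = T xi h.
Proof.
case=> A AE _ xi h; rewrite /tilde; case: xgetP => [E _ ->//|/(_ A)].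
by move=> /(_ AE).
Qed.
End TensorOperators.

(** * Closed subspaces and total families *)

Section ClosedSubspaces.
Context {R : realType}.
Local Notation C := R[i].

Definition closed_subspace (V : hilbertType R) (P : V -> Prop) :=
  [/\ P 0, forall c x y, P x -> P y -> P (c *: x + y) &
      forall x, (forall eps : C, 0 < eps -> exists2 y, P y & `|x - y| < eps) -> P x].

Lemma closed_subspace_sum (V : hilbertType R) (P : V -> Prop) (I : Type)
    (s : seq I) (c : I -> C) (f : I -> V) :
  closed_subspace P -> (forall i, P (f i)) -> P (\sum_(i <- s) c i *: f i).
Proof.
case=> P0 PD _ Pf; elim: s => [|i s IH]; first by rewrite big_nil.
by rewrite big_cons; apply: PD.
Qed.

Lemma closed_subspace_eq (V W : hilbertType R) (A B : bop V W) :
  closed_subspace (fun x => A x = B x).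
Proof.
split=> [|c x y Ax Ay|x xP]; first by rewrite !linear0.
  by rewrite !linearP Ax Ay.
have [M M0 AM] := bop_bounded A; have [N N0 BN] := bop_bounded B.
apply: norm_le_eps_eq => eps e0; have MN : 0 < M + N by rewrite addr_gt0.
have [|y Ay xy] := xP (eps / (M + N)); first by rewrite divr_gt0.
have -> : A x - B x = A (x - y) - B (x - y).
  by rewrite [A (x - y)]linearB [B (x - y)]linearB Ay opprB addrA subrK.
rewrite (le_trans (ler_normB _ _))// (le_trans (lerD (AM _) (BN _)))// -mulrDl.
by rewrite mulrC -ler_pdivlMr// ltW.
Qed.

Lemma closed_subspace_preim (V W : hilbertType R) (A : bop V W) (P : W -> Prop) :
  closed_subspace P -> closed_subspace (fun x => P (A x)).
Proof.
case=> P0 PD PC; split=> [|c x y Ax Ay|x xP]; first by rewrite linear0.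
  by rewrite linearP; exact: PD.
have [M M0 AM] := bop_bounded A; apply: PC => eps e0.
have [|y Py xy] := xP (eps / M); first by rewrite divr_gt0.
exists (A y) => //; rewrite -linearB (le_lt_trans (AM _))//.
by rewrite mulrC -ltr_pdivlMr.
Qed.

(** Density of the span, stated as an induction principle; with [closed_subspace_eq] it reduces
    equality of bounded operators to the members of [e]. *)
Definition total_family (V : hilbertType R) (J : Type) (e : J -> V) :=
  forall P : V -> Prop, closed_subspace P -> (forall a, P (e a)) -> forall x, P x.

Lemma total_tens (H K : hilbertType R) :
  total_family (fun p : H * K => p.1 \ox p.2).
Proof.
move=> P cP Pt z; case: (cP) => _ _ PC; apply: PC => eps /gt0_Re[-> e0].
have [u uP] := tens_dense z e0; exists (\sum_(p <- u) p.1 *: (p.2.1 \ox p.2.2)) => //.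
by apply: closed_subspace_sum => // a; exact: Pt.
Qed.

Lemma total_onb (V : hilbertType R) (J : choiceType) (e : J -> V) :
  orthonormal_basis e -> total_family e.
Proof.
move=> [_ de] P cP Pe x; case: (cP) => _ _ PC; apply: PC => eps e0.
have [||y [yB [s ys]]] := de (ball x eps).
- by exists x; exact: ballxx.
- exact: ball_open.
exists y; first by rewrite ys; apply: closed_subspace_sum => // p; exact: Pe.
by move: yB; rewrite -ball_normE.
Qed.

Lemma total_tens_family (V W : hilbertType R) (I J : Type) (e : I -> V) (f : J -> W) :
  total_family e -> total_family f ->
  total_family (fun p : I * J => e p.1 \ox f p.2).
Proof.
move=> te tf P cP Pef; apply: total_tens => // -[x y] /=.
(* One factor at a time: with the other factor fixed, [P] pulls back to a closed subspace of the
   remaining one. *)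
rewrite -tensrE; apply: (te _ (closed_subspace_preim (tensr V y) cP)) => a.
rewrite tensrE -tenslE.
apply: (tf _ (closed_subspace_preim (tensl W (e a)) cP)) => b.
by rewrite tenslE; exact: (Pef (a, b)).
Qed.
End ClosedSubspaces.

(** * Unordered sums and orthonormal expansions *)

Section HasSum.
Context {R : realType}.
Local Notation C := R[i].
Implicit Types V W H : hilbertType R.

Lemma partial_sumE (V : zmodType) (J : choiceType) (f : J -> V) (B : {fset J}) :
  partial_sum f B = \sum_(a <- B) f a.
Proof. by rewrite /partial_sum big_seq_fsetE. Qed.

Lemma has_sumP V (J : choiceType) (f : J -> V) (x : V) :
  has_sum f x <-> forall eps : C, 0 < eps -> exists A : {fset J},
    forall B : {fset J}, (A `<=` B)%fset -> `|x - \sum_(a <- B) f a| < eps.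
Proof.
apply: iff_trans (@cvgrPdist_lt _ V _ totally totally_filter (partial_sum f) x) _.
split=> fx eps /fx[A] => [_ AP|AP].
  by exists A => B /AP; rewrite /= partial_sumE.
by exists A => // B AB; rewrite /= partial_sumE; exact: AP.
Qed.

Lemma has_sum_unique V (J : choiceType) (f : J -> V) (x y : V) :
  has_sum f x -> has_sum f y -> x = y.
Proof.
exact: (@cvg_unique V (@norm_hausdorff _ V) _
  (fmap_proper_filter (partial_sum f) totally_filter)).
Qed.

Lemma eq_has_sum V (J : choiceType) (f g : J -> V) (x y : V) :
  f =1 g -> x = y -> has_sum f x -> has_sum g y.
Proof. by move=> /funext -> ->. Qed.

Lemma has_sum_bop V W (J : choiceType) (A : bop V W) (f : J -> V) (x : V) :
  has_sum f x -> has_sum (fun a => A (f a)) (A x).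
Proof.
move=> /has_sumP fx; apply/has_sumP => eps e0; have [M M0 AM] := bop_bounded A.
have [|D DP] := fx (eps / M); first by rewrite divr_gt0.
exists D => B /DP xB; rewrite -linear_sum -linearB (le_lt_trans (AM _))//.
by rewrite mulrC -ltr_pdivlMr.
Qed.

Lemma has_sum_single V (J : choiceType) (f : J -> V) (a : J) :
  (forall b, b != a -> f b = 0) -> has_sum f (f a).
Proof.
move=> f0; apply/has_sumP => eps e0; exists [fset a]%fset => B.
rewrite fsub1set => aB; rewrite (big_fsetD1 a)//= big_seq big1 ?addr0 ?subrr ?normr0//.
by move=> b; rewrite !inE => /andP[/f0].
Qed.

Lemma has_sum_linear V (J : choiceType) (f g : J -> V) (c : C) (x y : V) :
  has_sum f x -> has_sum g y -> has_sum (fun a => c *: f a + g a) (c *: x + y).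
Proof.
move=> /has_sumP xP /has_sumP yP; apply/has_sumP => eps e0.
have e20 : 0 < eps / 2 by rewrite divr_gt0.
have c0 : 0 < `|c| + 1 by rewrite ltr_wpDl.
have [|A AP] := xP (eps / 2 / (`|c| + 1)); first by rewrite divr_gt0.
have [D DP] := yP _ e20; exists (A `|` D)%fset => B.
rewrite fsubUset => /andP[/AP xB /DP yB].
rewrite big_split -scaler_sumr opprD addrACA -scalerBr.
rewrite (le_lt_trans (ler_normD _ _))// [eps]splitr ler_ltD// normrZ.
apply: (@le_trans _ _ ((`|c| + 1) * `|x - \sum_(a <- B) f a|)).
  by rewrite ler_wpM2r// lerDl.
by rewrite mulrC -ler_pdivlMr// ltW.
Qed.

Lemma has_sum0 V (J : choiceType) (f : J -> V) : (forall a, f a = 0) -> has_sum f 0.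
Proof.
by move=> f0; apply/has_sumP => eps e0; exists fset0 => B _; rewrite big1 ?subrr ?normr0.
Qed.

Lemma has_sum_norm_le V (J : choiceType) (f : J -> V) (x : V) (M : C) :
  has_sum f x -> (forall B : {fset J}, `|\sum_(a <- B) f a| <= M) -> `|x| <= M.
Proof.
move=> /has_sumP fx fM; apply/ler_addgt0Pr => eps /fx[A /(_ A)].
rewrite fsubset_refl => /(_ isT) xA; rewrite -(subrK (\sum_(a <- A) f a) x).
by rewrite (le_trans (ler_normD _ _))// addrC lerD// ltW.
Qed.

(* The partial sums of mutually orthogonal projections are contractions, so
   their strong convergence to the identity may be tested on a total family. *)
Lemma closed_has_sum_proj V (J : choiceType) (Q : J -> V -> V) :
  (forall a, linear (Q a)) ->
  (forall a b v, inner (Q a v) (Q b v) = (a == b)%:R * inner v (Q b v)) ->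
  closed_subspace (fun v => has_sum (fun a => Q a v) v).
Proof.
move=> lQ oQ.
have sumP (B : {fset J}) c x y : \sum_(a <- B) Q a (c *: x + y) =
    c *: (\sum_(a <- B) Q a x) + \sum_(a <- B) Q a y.
  by rewrite scaler_sumr -big_split; apply: eq_bigr => a _; rewrite lQ.
have bessel (B : {fset J}) v : `|\sum_(a <- B) Q a v| <= `|v|.
  set s := \sum_(a <- B) _.
  have [->|s0] := eqVneq s 0; first by rewrite normr0.
  rewrite -(ler_pM2r (_ : 0 < `|s|)) ?normr_gt0// -expr2 -inner_norm.
  (* Bessel's inequality: [oQ] removes the off-diagonal terms of [inner s s] and leaves
     [inner v s]. *)
  suff ss : inner s s = inner v s.
    by rewrite -[inner s s]ger0_norm ?inner_ge0// ss cauchy_schwarz.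
  rewrite [in LHS]/s inner_suml [in RHS]/s inner_sumr.
  under eq_bigr do rewrite inner_sumr.
  rewrite exchange_big /= big_seq [RHS]big_seq; apply: eq_bigr => b bB.
  rewrite (bigD1_seq b)//= oQ eqxx mul1r big1 ?addr0// => a ab.
  by rewrite oQ (negbTE ab) mul0r.
split=> [|c x y xP yP|x xP].
- have Q0 a : Q a 0 = 0.
    have := lQ a 1 0 0; rewrite !scale1r addr0 => /eqP.
    by rewrite -[X in X == _]addr0 (inj_eq (addrI _)) eq_sym => /eqP.
  exact: has_sum0.
- have := has_sum_linear (c := c) xP yP; apply: eq_has_sum => // a.
  by rewrite lQ.
apply/has_sumP => eps e0; have e30 : 0 < eps / 3 by rewrite divr_gt0.
have [y /has_sumP/(_ _ e30)[A AP] xy] := xP _ e30; exists A => B /AP yB.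
have Qxy : (y - \sum_(a <- B) Q a y) - \sum_(a <- B) Q a (x - y) =
    y - \sum_(a <- B) Q a x.
  have -> : x - y = (-1) *: y + x by rewrite scaleN1r addrC.
  by rewrite sumP scaleN1r opprD opprK addrA subrK.
rewrite -(subrKA y x) -Qxy.
rewrite (le_lt_trans (ler_normD _ _))//.
rewrite (_ : eps = eps / 3 + (eps / 3 + eps / 3)); last by field.
rewrite ltrD// (le_lt_trans (ler_normB _ _))// ltrD//.
by rewrite (le_lt_trans (bessel _ _)).
Qed.

Definition orthonormal (V : hilbertType R) (J : eqType) (e : J -> V) :=
  forall a b, inner (e a) (e b) = (a == b)%:R.

(** The rank-one projections along the [e a] satisfy [closed_has_sum_proj], and at a vector [e a] a
    single term of the sum survives. *)
Lemma onb_expansion V (J : choiceType) (e : J -> V) :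
  orthonormal e -> total_family e ->
  forall x, has_sum (fun a => inner (e a) x *: e a) x.
Proof.
move=> oe te; apply: (te (fun x => has_sum (fun a => inner (e a) x *: e a) x)) => [|a].
  apply: (@closed_has_sum_proj V J (fun a x => inner (e a) x *: e a)) => [a c x y|a b v].
    by rewrite innerPr scalerDl scalerA.
  rewrite innerZl !innerZr oe -inner_conj.
  by case: eqVneq => [->|_]; rewrite ?mulr0 ?mul0r// mulr1 mul1r mulrC.
have := @has_sum_single V J (fun b => inner (e b) (e a) *: e b) a.
rewrite oe eqxx scale1r; apply=> b ba.
by rewrite oe (negbTE ba) scale0r.
Qed.

Lemma orthonormal_tens V W (I J : choiceType) (e : I -> V) (f : J -> W) :
  orthonormal e -> orthonormal f -> orthonormal (fun p : I * J => e p.1 \ox f p.2).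
Proof.
by move=> oe of_ [a b] [c d]; rewrite inner_tens oe of_ xpair_eqE -natrM mulnb.
Qed.
End HasSum.

(** * Slices of a tensor along the first factor *)

Section Slices.
Context {R : realType} {F H : hilbertType R}.
Local Notation C := R[i].

Definition slice (x : F) : bop (tensor F H) H := adjoint (tensl H x).

Lemma inner_slice x v h : inner h (slice x v) = inner (x \ox h) v.
Proof. by rewrite /slice adjointPr tenslE. Qed.

Lemma slice_tens x y h : slice x (y \ox h) = inner x y *: h.
Proof. by apply: inner_injr => z; rewrite inner_slice inner_tens innerZr. Qed.

Context {J : choiceType} {e : J -> F} (be : orthonormal_basis e).

(** The terms are the orthogonal projections of [v] onto the subspaces [e a \ox H]; on elementary
    tensors the claim is the orthonormal expansion of the first factor. *)
Lemma slice_expansion v : has_sum (fun a => e a \ox slice (e a) v) v.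
Proof.
have [oe _] := be; move: v.
apply: (total_tens (P := fun v => has_sum (fun a => e a \ox slice (e a) v) v)) => [|[x h]].
  apply: (@closed_has_sum_proj _ _ J (fun a v => e a \ox slice (e a) v)) => [a c v w|a b v].
    by rewrite linearP -!tenslE linearP.
  rewrite inner_tens oe; case: eqVneq => [->|_]; last by rewrite !mul0r.
  by rewrite !mul1r [RHS]inner_conj -inner_slice -inner_conj.
have := has_sum_bop (A := tensr F h) (onb_expansion oe (total_onb be) (x := x)).
apply: eq_has_sum => [a|]; last by rewrite tensrE.
by rewrite tensrE slice_tens tensZl tensZr.
Qed.

Lemma slice_ext v w : (forall a, slice (e a) v = slice (e a) w) -> v = w.
Proof.
move=> vw; apply: (has_sum_unique (@slice_expansion v)).
apply: eq_has_sum (@slice_expansion w) => // a.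
by rewrite vw.
Qed.
End Slices.

(** * One fiber: complete contractivity and the row condition *)

Section CoordinateRepresentation.
Context {R : realType}.
Local Notation C := R[i].

Lemma eq_adjoint (H K : hilbertType R) (A B : bop H K) :
  A =1 B -> adjoint A =1 adjoint B.
Proof. by move=> AB; apply: adjoint_unique => x y; rewrite adjointPr AB. Qed.

Section OneFiber.
Context {F H : hilbertType R} {T : F -> bop H H} {J : choiceType} {e : J -> F}.
Hypothesis be : orthonormal_basis e.

Lemma coordinate_basis (S : J -> bop H H) :
  (forall xi h, has_sum (fun a => inner (e a) xi *: S a h) (T xi h)) ->
  forall a, S a =1 T (e a).
Proof.
move=> TS a h; have [oe _] := be; apply: has_sum_unique (TS (e a) h).
have := @has_sum_single _ _ _ (fun b => inner (e b) (e a) *: S b h) a.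
rewrite oe eqxx scale1r; apply=> b ba.
by rewrite oe (negbTE ba) scale0r.
Qed.

(** The row condition makes the finite columns [v |-> \sum e a \ox adjoint (S a) v] contractions,
    hence also their adjoints, the finite row sums; on combinations of elementary tensors these
    converge to the induced map. *)
Lemma row_contractive_cc (S : J -> bop H H) :
  (forall xi h, has_sum (fun a => inner (e a) xi *: S a h) (T xi h)) ->
  (exists2 P : bop H H,
    sot_sum (fun a h => S a (adjoint (S a) h)) P & op_le P (idop H)) ->
  completely_contractive T.
Proof.
move=> TS [P SP P1]; have [oe _] := be.
have colE (B : {fset J}) v : `|\sum_(a <- B) e a \ox adjoint (S a) v| ^+ 2 =
    \sum_(a <- B) inner v (S a (adjoint (S a) v)).
  rewrite -inner_norm inner_suml big_seq [RHS]big_seq; apply: eq_bigr => a aB.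
  rewrite inner_sumr (bigD1_seq a)//= inner_tens oe eqxx mul1r adjointP.
  by rewrite big1 ?addr0// => b ba; rewrite inner_tens oe eq_sym (negbTE ba) mul0r.
have term_ge0 a v : 0 <= inner v (S a (adjoint (S a) v)).
  by rewrite -adjointP inner_ge0.
have col_le (B : {fset J}) v : `|\sum_(a <- B) e a \ox adjoint (S a) v| <= `|v|.
  rewrite -(@ler_pXn2r _ 2)// ?nnegrE// colE -inner_norm.
  apply/ler_addgt0Pr => eps e0; have v0 : 0 < `|v| + 1 by rewrite ltr_wpDl.
  have /has_sumP/(_ (eps / (`|v| + 1)))[|A AP] := SP v; first by rewrite divr_gt0.
  (* Past [A] the partial sums are close to [P v]; adjoining [B] keeps them close, and by [term_ge0]
     the sum over [D] dominates that over [B]. *)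
  have {AP} := AP (A `|` B)%fset (fsubsetUl _ _); set D := (A `|` B)%fset => DP.
  apply: (@le_trans _ _ (\sum_(a <- D) inner v (S a (adjoint (S a) v)))).
    rewrite [leRHS](big_fsetID _ (mem B)) /=.
    have -> : [fset x in D | x \in mem B]%fset = B.
      by apply/fsetP => x; rewrite !inE /= orbC andb_idl// => ->.
    by rewrite lerDl sumr_ge0.
  rewrite -(subrK (inner v (P v)) (\sum_(a <- D) _)) addrC lerD//.
  (* Comparable complex numbers have equal imaginary parts, so [P1] forces this inner product to be
     real. *)
  have vPr : inner v (P v) \is Num.real.
    by rewrite (ler_real (P1 v)) /= ger0_real// inner_ge0.
  apply: le_trans (real_ler_norm _) _.
    by rewrite rpredB// ger0_real// sumr_ge0.
  rewrite -inner_sumr distrC -innerBr.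
  rewrite (le_trans (cauchy_schwarz _ _))//.
  apply: (@le_trans _ _ ((`|v| + 1) * `|P v - \sum_(a <- D) S a (adjoint (S a) v)|)).
    by rewrite ler_wpM2r// lerDl.
  by rewrite mulrC -ler_pdivlMr// ltW.
have rowE (B : {fset J}) w v :
    inner (\sum_(a <- B) S a (slice (e a) w)) v =
    inner w (\sum_(a <- B) e a \ox adjoint (S a) v).
  rewrite inner_suml inner_sumr; apply: eq_bigr => a _.
  by rewrite -adjointPr inner_conj inner_slice -inner_conj.
have row_le (B : {fset J}) w : `|\sum_(a <- B) S a (slice (e a) w)| <= `|w|.
  set r := \sum_(a <- B) _.
  have [->|r0] := eqVneq r 0; first by rewrite normr0.
  rewrite -(ler_pM2r (_ : 0 < `|r|)) ?normr_gt0// -expr2 -inner_norm.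
  rewrite -[inner _ _]ger0_norm ?inner_ge0// {1}/r rowE.
  by rewrite (le_trans (cauchy_schwarz _ _))// ler_wpM2l.
have [u|A [AE Ab]] := @bop_extend _ (F * H) (tensor F H) H
    (fun p => p.1 \ox p.2) (fun p => T p.1 p.2) 1 ler01; last first.
  by exists A => [xi h|x]; [exact: (AE (xi, h))|have := Ab x; rewrite mul1r].
rewrite mul1r; set w := \sum_(a <- u) a.1 *: (a.2.1 \ox a.2.2).
(* The uniform bound on row sums passes to their limit, which is identified by induction on [u] from
   the expansion [TS]. *)
apply: has_sum_norm_le (fun B => row_le B w).
rewrite {}/w; elim: u => [|p u IH].
  by rewrite !big_nil; apply: has_sum0 => a; rewrite !linear0.
have := has_sum_linear (c := p.1) (TS p.2.1 p.2.2) IH; rewrite !big_cons.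
apply: eq_has_sum => // a.
by rewrite [slice _ (_ + _)]linearP slice_tens [S a (_ + _)]linearP [S a (_ *: _)]linearZ.
Qed.

Hypothesis ccT : completely_contractive T.

Lemma tilde_contraction : Defs.contraction (tilde T).
Proof.
case: (ccT) => A AE Ac x; suff -> : tilde T x = A x by [].
apply: (total_tens (closed_subspace_eq (tilde T) A)) => -[xi h] /=.
by rewrite tildeE// AE.
Qed.

Lemma coordinate_sum xi h :
  has_sum (fun a => inner (e a) xi *: T (e a) h) (T xi h).
Proof.
have [oe _] := be.
have := has_sum_bop (A := bcomp (tilde T) (tensr F h))
  (onb_expansion oe (total_onb be) (x := xi)).
apply: eq_has_sum => [a|] /=; last by rewrite tensrE tildeE.
by rewrite linearZ /= linearZ /= tensrE tildeE.
Qed.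

(** Both sides are adjoints of [h |-> tilde T (x \ox h)]. *)
Lemma slice_adjoint_tilde x v : slice x (adjoint (tilde T) v) = adjoint (T x) v.
Proof.
apply/esym/(@adjoint_comp _ _ _ _ (tilde T) (tensl H x)) => h /=.
by rewrite tenslE tildeE.
Qed.

Lemma row_contractive_sum : exists2 P : bop H H,
  sot_sum (fun a h => T (e a) (adjoint (T (e a)) h)) P & op_le P (idop H).
Proof.
(* The row sum is [tilde T] composed with its adjoint: one expands the adjoint in slices and applies
   [tilde T] term by term. *)
exists (bcomp (tilde T) (adjoint (tilde T))) => h.
  have := has_sum_bop (A := tilde T) (slice_expansion be (v := adjoint (tilde T) h)).
  by apply: eq_has_sum => // a; rewrite tildeE// slice_adjoint_tilde.
rewrite /= -adjointP !inner_norm ler_pXn2r ?nnegrE//.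
rewrite -[leRHS]mul1r; apply: adjoint_bound => // x.
by rewrite mul1r; exact: tilde_contraction.
Qed.
End OneFiber.
End CoordinateRepresentation.

(** * Two fibers: expansions of both sides of the commutation relations *)

Section TwoFibers.
Context {R : realType} {F G H : hilbertType R}.
Local Notation C := R[i].
Variables (T : F -> bop H H) (T' : G -> bop H H) (U : bop H H).
Variable t : bop (tensor F G) (tensor G F).
Hypotheses (ccT : completely_contractive T) (ccT' : completely_contractive T').
Context {I J : choiceType} {e : I -> F} {f : J -> G}.
Hypotheses (be : orthonormal_basis e) (bf : orthonormal_basis f).

Definition tilde2 : bop (tensor (tensor F G) H) H :=
  bcomp (tilde T) (bcomp (idop F \otimes tilde T') (tassoc F G H)).

Lemma tilde2E x y h : tilde2 (x \ox y \ox h) = T x (T' y h).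
Proof. by rewrite /= tassocE tensopE !tildeE. Qed.

Lemma tilde2_sum z h :
  has_sum (fun p : I * J => inner (e p.1 \ox f p.2) z *: T (e p.1) (T' (f p.2) h))
    (tilde2 (z \ox h)).
Proof.
have [[oe _] [of_ _]] := (be, bf).
have := has_sum_bop (A := bcomp tilde2 (tensr _ h))
  (onb_expansion (orthonormal_tens oe of_)
    (total_tens_family (total_onb be) (total_onb bf)) (x := z)).
apply: eq_has_sum => [p|]; last by rewrite bcompE tensrE.
by rewrite linearZ bcompE tensrE tilde2E.
Qed.

(* The right-hand side of the doubly twisted relation. *)
Definition cross : bop (tensor F H) (tensor G H) :=
  bcomp (idop G \otimes tilde T) (bcomp (tassoc G F H) (bcomp (t \otimes U)
    (bcomp (tassocV F G H) (idop F \otimes adjoint (tilde T'))))).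

(** Slicing acts on [G] and [tilde T] on the other two factors, so the two commute; this is checked
    on elementary tensors [z]. *)
Lemma slice_tilde (y : G) (z : tensor G F) h :
  slice y ((idop G \otimes tilde T) (tassoc G F H (z \ox h))) =
  tilde T (slice y z \ox h).
Proof.
have := @total_tens R G F _ (closed_subspace_eq
  (bcomp (slice y) (bcomp (idop G \otimes tilde T) (bcomp (tassoc G F H) (tensr _ h))))
  (bcomp (tilde T) (bcomp (tensr F h) (slice y)))).
move=> /(_ _ z) /=; rewrite !tensrE; apply=> -[g x] /=.
by rewrite !tensrE tassocE tensopE !slice_tens tensZl linearZ tildeE.
Qed.

(** The inner sum over [d] for fixed [c] in closed form: the coefficients
    [inner (b \ox e d) (t (x \ox c))] are the coordinates of [slice b (t (x \ox c))]. *)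
Definition cross_term (x : F) (b c : G) : bop H H :=
  bcomp (T (slice b (t (x \ox c)))) (bcomp U (adjoint (T' c))).

Lemma cross_term_sum x b c h :
  has_sum (fun d => inner (b \ox e d) (t (x \ox c)) *:
             T (e d) (U (adjoint (T' c) h))) (cross_term x b c h).
Proof.
have := coordinate_sum be ccT (xi := slice b (t (x \ox c)))
  (h := U (adjoint (T' c) h)).
by apply: eq_has_sum => // d; rewrite inner_slice.
Qed.

(** The slice expansion of [adjoint (tilde T') h] is pushed through the remaining bounded factors of
    [cross]. This is the outer sum of the iterated sum. *)
Lemma slice_cross x b h :
  has_sum (fun c => cross_term x b (f c) h) (slice b (cross (x \ox h))).
Proof.
have := has_sum_bop (A := bcomp (slice b) (bcomp (idop G \otimes tilde T)
  (bcomp (tassoc G F H) (bcomp (t \otimes U) (bcomp (tassocV F G H) (tensl _ x))))))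
  (slice_expansion bf (v := adjoint (tilde T') h)).
apply: eq_has_sum => [c|] /=; last by rewrite tenslE tensopE.
rewrite tenslE tassocVE tensopE slice_tilde slice_adjoint_tilde//.
by rewrite tildeE.
Qed.
End TwoFibers.

(** * The full family: passage between operators and coordinates *)

Section Family.
Context {R : realType} {k : nat} {E : product_system R k}.
Context {J : 'I_k -> choiceType} {e : forall i, J i -> E i}.
Hypothesis be : forall i, orthonormal_basis (@e i).
Context {H : hilbertType R} {T : forall i, E i -> bop H H}.
Context {U : 'I_k -> 'I_k -> bop H H}.
Hypotheses (linT : forall i, linear_family (@T i))
  (unitU : forall i j, i != j -> unitary_op (U i j))
  (adjU : forall i j, i != j -> U j i =1 adjoint (U i j))
  (commU : forall i j, i != j ->
     forall l (xi : E l), U i j \o @T l xi =1 @T l xi \o U i j).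

Let S0 (i : 'I_k) (a : J i) : bop H H := @T i (@e i a).

Lemma coordinate_eq (S : forall i, J i -> bop H H) :
  coordinate_expansion T e S -> forall i a, S i a =1 S0 a.
Proof. by move=> TS i; apply: (coordinate_basis (be i)) => xi h; exact: TS. Qed.

Lemma twisted_rep_coordinates : twisted_rep T U ->
  [/\ coordinate_expansion T e S0, row_contractive S0 & coordinate_twisted U e S0].
Proof.
move=> [_ ccT _ _ _ tT]; split.
- by move=> i xi h; exact: coordinate_sum.
- by move=> i; exact: row_contractive_sum.
- move=> i j ij a b h.
  (* The fibers enter in the order [j], [i]: this expands the right-hand side of the twist relation
     at [e a \ox e b \ox h], and [tT] then identifies its value with the left-hand side. *)
  have := tilde2_sum (ccT j) (ccT i) (be j) (be i)
    (z := flip E i j (@e i a \ox @e j b)) (h := U i j h).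
  apply: eq_has_sum => //=.
  have := tT i j ij (@e i a \ox @e j b \ox h); rewrite /= tensopE => <-.
  by rewrite tassocE tensopE !tildeE.
Qed.

Lemma coordinates_twisted_rep (S : forall i, J i -> bop H H) :
  coordinate_expansion T e S -> row_contractive S -> coordinate_twisted U e S ->
  twisted_rep T U.
Proof.
move=> TS rS tS; have SE := coordinate_eq TS.
(* This comes first, since [tilde] is known to be the induced map only under complete
   contractivity. *)
have ccT i : completely_contractive (@T i).
  by apply: (row_contractive_cc (be i)) (rS i) => xi h; exact: TS.
split=> // [i j l ij v /=|i j ij v /=].
  apply: (total_tens (closed_subspace_eq (bcomp (U i j) (tilde (@T l)))
    (bcomp (tilde (@T l)) (idop (E l) \otimes U i j)))) => -[xi h] /=.
  by rewrite tensopE !tildeE//; exact: commU.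
have tot : total_family (fun p : J i * J j * H => @e i p.1.1 \ox @e j p.1.2 \ox p.2).
  apply: (@total_tens_family R _ _ _ _ (fun p : J i * J j => @e i p.1 \ox @e j p.2) id) => //.
  by apply: total_tens_family; exact: total_onb.
apply: (tot _ (closed_subspace_eq (tilde2 (@T i) (@T j))
  (bcomp (tilde2 (@T j) (@T i)) (flip E i j \otimes U i j)))) => -[[a b] h] /=.
rewrite tassocE tensopE !tildeE// -!SE tensopE.
apply: has_sum_unique (tS i j ij a b h) _.
apply: eq_has_sum (tilde2_sum (ccT j) (ccT i) (be j) (be i)
  (z := flip E i j (@e i a \ox @e j b)) (h := U i j h)) => // p.
by rewrite !SE.
Qed.

Lemma doubly_twisted_coordinates : doubly_twisted_rep T U ->
  coordinate_doubly_twisted U e S0.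
Proof.
move=> [[_ ccT _ _ _ _] dT] i j ij a b.
exists (fun c => cross_term (@T i) (@T j) (U i j) (flip E i j) (@e i a) (@e j b) (@e j c)).
  by move=> c h; exact: cross_term_sum.
move=> h; have := slice_cross (U := U i j) (t := flip E i j) (ccT i) (ccT j) (be j)
  (x := @e i a) (b := @e j b) (h := h).
apply: eq_has_sum => //.
have dTa : adjoint (tilde (@T j)) (tilde (@T i) (@e i a \ox h)) =
    cross (@T i) (@T j) (U i j) (flip E i j) (@e i a \ox h).
  exact: dT.
by rewrite -dTa slice_adjoint_tilde// tildeE.
Qed.

Lemma coordinates_doubly_twisted (S : forall i, J i -> bop H H) :
  coordinate_expansion T e S -> twisted_rep T U ->
  coordinate_doubly_twisted U e S -> doubly_twisted_rep T U.
Proof.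
move=> TS tT dS; split=> // i j ij v; have [_ ccT _ _ _ _] := tT.
have SE := coordinate_eq TS.
have tot : total_family (fun p : J i * H => @e i p.1 \ox p.2).
  by apply: (@total_tens_family R _ _ _ _ (@e i) id) => //; exact: total_onb.
apply: (tot _ (closed_subspace_eq (bcomp (adjoint (tilde (@T j))) (tilde (@T i)))
  (cross (@T i) (@T j) (U i j) (flip E i j)))) => -[a h].
(* Slicing along [e b] turns the left-hand side into [adjoint (S b)] applied to [S a h]. *)
apply: (slice_ext (be j)) => b; rewrite [X in slice _ X = _]/=.
rewrite slice_adjoint_tilde// tildeE//.
have [X SX sX] := dS i j ij a b.
apply: has_sum_unique (slice_cross (U := U i j) (t := flip E i j) (ccT i) (ccT j) (be j)
  (x := @e i a) (b := @e j b) (h := h)).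
apply: eq_has_sum (sX h) => [c|]; last by rewrite /= (eq_adjoint (SE j b)) SE.
(* [X c] is given only as a sum over [d]; uniqueness of sums identifies it with [cross_term]. *)
apply: has_sum_unique (SX c h) _.
apply: eq_has_sum (cross_term_sum (T' := @T j) (U := U i j) (t := flip E i j) (ccT i) (be i)
  (x := @e i a) (b := @e j b) (c := @e j c) (h := h)) => // d.
by rewrite SE (eq_adjoint (SE j c)).
Qed.
End Family.

Theorem theorem5p12 (R : realType) (k : nat) (E : product_system R k)
  (sepE : forall i, separable_space (E i))
  (J : 'I_k -> choiceType) (e : forall i, J i -> E i)
  (basis_e : forall i, orthonormal_basis (@e i))
  (H : hilbertType R) (sepH : separable_space H)
  (T : forall i, E i -> bop H H) (linT : forall i, linear_family (@T i))
  (U : 'I_k -> 'I_k -> bop H H)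
  (unitU : forall i j, i != j -> unitary_op (U i j))
  (adjU : forall i j, i != j -> U j i =1 adjoint (U i j))
  (commU : forall i j, i != j ->
     forall l (xi : E l), U i j \o T l xi =1 T l xi \o U i j) :
  (twisted_rep T U <->
     exists S : forall i, J i -> bop H H,
       [/\ coordinate_expansion T e S,
           row_contractive S &
           coordinate_twisted U e S]) /\
  (doubly_twisted_rep T U <->
     exists S : forall i, J i -> bop H H,
       [/\ coordinate_expansion T e S,
           row_contractive S,
           coordinate_twisted U e S &
           coordinate_doubly_twisted U e S]) /\
  (forall S : forall i, J i -> bop H H, coordinate_expansion T e S ->
     forall i, completely_contractive (@T i) ->
     forall (a : J i) h, S i a h = tilde (@T i) (e i a \ox h)).
Proof.
split; [split=> [tT|[S [TS rS tS]]]|split; [split=> [dT|[S [TS rS tS dS]]]|]].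
- by exists (fun i a => T i (e i a)); exact: twisted_rep_coordinates.
- exact: (coordinates_twisted_rep basis_e linT unitU adjU commU TS).
- exists (fun i a => T i (e i a)).
  have [TS rS tS] := twisted_rep_coordinates basis_e dT.1.
  by split => //; exact: doubly_twisted_coordinates.
- apply: (coordinates_doubly_twisted basis_e TS) => //.
  exact: (coordinates_twisted_rep basis_e linT unitU adjU commU TS).
- by move=> S TS i ccT a h; rewrite tildeE// (coordinate_eq basis_e TS).
Qed.
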